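(* As $n\to\infty$: (a) $H_n(C_6)\le n^{\frac{2}{3}n+o(n)}$; (b) $H_n(C_8)\le n^{\frac{4}{5}n+o(n)}$; (c) $H_n(C_{10})\le n^{\frac{4}{5}n+o(n)}$.
   Context: For a graph $G$, $H_n(G)$ denotes the maximum number of Hamilton paths in the complete graph $K_n$ such that the union of any two of them contains $G$ as a subgraph. $C_m$ denotes the cycle of length $m$. *)

(* Defs.v *)
From mathcomp Require Import all_boot.
Set Implicit Arguments. Unset Strict Implicit. Unset Printing Implicit Defensive.

(* Vertices of K_n are 'I_n.  A graph (edge set) on 'I_n is a set of
   2-element subsets of 'I_n. *)

Definition path_edges n (p : seq 'I_n) : {set {set 'I_n}} :=
  [set [set x.1; x.2] | x in zip p (behead p)].

Definition is_ham_path n (E : {set {set 'I_n}}) : bool :=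
  [exists p : n.-tuple 'I_n, uniq p && (E == path_edges p)].

Definition contains_cycle n (m : nat) (E : {set {set 'I_n}}) : bool :=
  [exists c : m.-tuple 'I_n,
    uniq c && cycle (fun x y => [set x; y] \in E) c].

Definition Cm_family n (m : nat) (F : {set {set {set 'I_n}}}) : bool :=
  [forall E in F, is_ham_path E] &&
  [forall E1 in F, forall E2 in F,
     (E1 != E2) ==> contains_cycle m (E1 :|: E2)].

Definition H_cycle (n m : nat) : nat :=
  \max_(F : {set {set {set 'I_n}}} | Cm_family m F) #|F|.

(* Main.v *)
(** Suppose that [I] indexes Hamilton paths of which any two have a union
    without C_m.  The bijection of the vertices that carries a path of [I] to a
    path of a C_m-creating family determines both paths, so the family has at
    most n^n / #|I| members.  It remains to find n^(n/k - o(n)) such paths, with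
    k = 3 for C_6 and k = 5 for C_8 and C_10.

    Over a field with q = 3^e elements join (p, u) to (x, v) when u + v = f p x.
    For f p x = (px, px^2) this graph on 2 q^3 vertices has no C_6, for
    (px, px^2, px^3, px^4) the one on 2 q^5 vertices has no C_10, and for
    (px, px^2, px^3, p^2 x) it has no C_8.  These q-regular graphs mix: if U is
    a positive proportion of one side, all but few vertices of the other side
    have about q |U| / q^k neighbours in U.  Hence a greedy path, which jumps to
    any unvisited vertex of the other side when its end has too few unvisited neighbours, has a
    constant times q choices at each step, and jumps rarely.

    About n / (2 q^k) disjoint copies of the graph are used, leaving o(n) extra
    vertices.  Each jump is replaced by a connector made of m extra vertices,
    too long to lie on a cycle C_m.  Paths for which the extra vertices have the
    same neighbours thus have a union without C_m, and the neighbours can be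
    prescribed in at most n^o(n) ways. *)

From HB Require Import structures.
Require Import Defs.
From mathcomp Require Import all_boot all_order all_algebra all_field zify.
From mathcomp Require ring lra.
Set Implicit Arguments. Unset Strict Implicit. Unset Printing Implicit Defensive.
Import Order.TTheory GRing.Theory Num.Theory.

(** * Consecutive vertices of a path *)

Section Consecutive.
Variable T : eqType.
Implicit Types (c z : seq T) (x y : T).

Definition consecutive c : rel T :=
  fun x y => ((x, y) \in zip c (behead c)) || ((y, x) \in zip c (behead c)).

Lemma consecutive_sym c x y : consecutive c x y = consecutive c y x.
Proof. by rewrite /consecutive orbC. Qed.

Lemma mem_zip_behead c x y :
  (x, y) \in zip c (behead c) -> (x \in c) && (y \in c).
Proof.
case: c => // w c; elim: c w => [|v c IH] w //=.
rewrite inE => /orP[/eqP[-> ->]|/IH /andP[xc yc]]; first by rewrite !inE !eqxx orbT.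
by move: xc yc; rewrite !inE => -> ->; rewrite !orbT.
Qed.

Lemma next_zip c x y : uniq c -> (x, y) \in zip c (behead c) -> next c x = y.
Proof.
case: c => // w c; rewrite [next _ _]/=; move: {4}w => z0.
elim: c w => [|v c IH] w //= /andP[wvc Uc].
rewrite inE => /orP[/eqP[-> ->]|xy]; first by rewrite eqxx.
have /andP[xvc _] := mem_zip_behead (c := v :: c) xy.
case: eqP => [xw|_]; first by rewrite -xw xvc in wvc.
exact: IH.
Qed.

Lemma prev_zip c x y : uniq c -> (x, y) \in zip c (behead c) -> prev c y = x.
Proof. by move=> Uc /(next_zip Uc) <-; rewrite prev_next. Qed.

Lemma consecutiveP c x y :
  uniq c -> consecutive c x y -> y = next c x \/ y = prev c x.
Proof.
move=> Uc /orP[/(next_zip Uc)<-|/(prev_zip Uc)<-]; [by left | by right].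
Qed.

Lemma next_neq_prev z x :
  uniq z -> 2 < size z -> x \in z -> next z x != prev z x.
Proof.
move=> Uz sz xz; apply/eqP => E.
have: next z (next z x) = x by rewrite E next_prev.
have [i s Es] := rot_to xz.
rewrite -!(next_rot i Uz) Es.
have := sz; rewrite -(size_rot i) Es; have := Uz; rewrite -(rot_uniq i) Es.
case: s {Es} => [|y [|w s]] //= /and3P[/norP[xy /norP[xw _]] _ _] _.
by rewrite eqxx eq_sym (negbTE xy) eqxx => Ew; rewrite Ew eqxx in xw.
Qed.

Lemma next_neq z x : uniq z -> 1 < size z -> x \in z -> next z x != x.
Proof.
move=> Uz sz xz; have [i s Es] := rot_to xz.
rewrite -(next_rot i Uz) Es.
have := sz; rewrite -(size_rot i) Es; have := Uz; rewrite -(rot_uniq i) Es.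
case: s {Es} => [|y s] //= /andP[/norP[xy _] _] _.
by rewrite eqxx eq_sym.
Qed.

Lemma sorted_zip (r : rel T) c :
  (forall x y, (x, y) \in zip c (behead c) -> r x y) -> sorted r c.
Proof.
case: c => // w c; elim: c w => [|v c IH] w //= H.
by rewrite H ?mem_head //=; apply: IH => x y xy; apply: H; rewrite inE xy orbT.
Qed.

Lemma zip_sorted (r : rel T) c x y :
  sorted r c -> (x, y) \in zip c (behead c) -> r x y.
Proof.
case: c => // w c; elim: c w => [|v c IH] w //= /andP[rwv Hc].
by rewrite inE => /orP[/eqP[-> ->]|]//; apply: IH.
Qed.

End Consecutive.

Lemma consecutive_map (T T' : eqType) (f : T -> T') (c : seq T) x y :
  injective f -> consecutive (map f c) (f x) (f y) = consecutive c x y.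
Proof.
move=> f_inj.
have E a b : ((f a, f b) \in zip (map f c) (behead (map f c))) =
             ((a, b) \in zip c (behead c)).
  have f2 : injective (fun p : T * T => (f p.1, f p.2)).
    by move=> [u v] [u' v'] /= [/f_inj -> /f_inj ->].
  rewrite -(mem_map f2); congr (_ \in _).
  case: c => // w c; elim: c w => [|v c IH] w //=.
  by rewrite [in LHS]/= in IH *; rewrite -IH.
by rewrite /consecutive !E.
Qed.

Lemma path_edgesP n (p : seq 'I_n) x y :
  x != y -> [set x; y] \in path_edges p -> consecutive p x y.
Proof.
move=> xy /imsetP[/= [a b]] /= ab /setP E; rewrite /consecutive.
have := E x; have := E y; rewrite !inE !eqxx orbT /=.
move=> /esym/orP[/eqP Ey|/eqP Ey] /esym/orP[/eqP Ex|/eqP Ex]; 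
  rewrite ?Ex ?Ey ?eqxx in xy *; rewrite // ?ab ?orbT //.
Qed.

Lemma cycle_map_consecutive n (T : eqType) (f : T -> 'I_n) (c1 c2 z : seq T) :
  injective f -> uniq z -> 1 < size z ->
  cycle (fun x y => [set x; y] \in path_edges (map f c1) :|: path_edges (map f c2))
    (map f z) ->
  cycle (fun x y => consecutive c1 x y || consecutive c2 x y) z.
Proof.
move=> f_inj Uz z_gt1 /(next_cycle (e := _)) Hz; apply: cycle_from_next => // x xz.
have := Hz _ (map_f f xz); rewrite next_map // inE.
have xn : f x != f (next z x).
  by rewrite (inj_eq f_inj) eq_sym next_neq.
by case/orP => /(path_edgesP xn); rewrite consecutive_map // => ->; rewrite ?orbT.
Qed.

(** * Joining path fragments by connectors *)

Section Connectors.
Variables (V0 X : finType) (adj : rel V0) (m : nat).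
Implicit Types (v w : V0) (s : seq V0) (ex : seq X).

Fixpoint breaks v s : nat :=
  if s is w :: s' then ~~ adj v w + breaks w s' else 0.

(** Surplus extra vertices go to the end, so the result is spanning as soon as [v :: s] lists [V0]
    and [ex] lists [X]. *)
Fixpoint connect_breaks v s ex : seq (V0 + X) :=
  if s is w :: s' then
    if adj v w then inl v :: connect_breaks w s' ex
    else inl v :: map inr (take m ex) ++ connect_breaks w s' (drop m ex)
  else inl v :: map inr ex.

Lemma perm_connect_breaks v s ex :
  perm_eq (connect_breaks v s ex) (map inl (v :: s) ++ map inr ex).
Proof.
elim: s v ex => [|w s IH] v ex //=; case: (adj v w); rewrite /= perm_cons //.
have {3}-> : ex = take m ex ++ drop m ex by rewrite cat_take_drop.
rewrite map_cat -cat_cons perm_sym perm_catCA perm_cat2l perm_sym; exact: IH.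
Qed.

Definition is_inl (a : V0 + X) := if a is inl _ then true else false.

(** Erasing the extra vertices recovers the path, so distinct paths stay distinct once connectors
    are inserted. *)
Lemma filter_connect_breaks v s ex :
  filter is_inl (connect_breaks v s ex) = map inl (v :: s).
Proof.
have E (l : seq X) : filter is_inl (map inr l) = [::] by elim: l.
elim: s v ex => [|w s IH] v ex /=; first by rewrite E.
by case: (adj v w); rewrite /= ?filter_cat ?E IH.
Qed.

Definition adj_sum (a b : V0 + X) :=
  match a, b with inl v, inl w => adj v w | _, _ => true end.

(** The bound on [size ex] reserves m vertices for each break and m for the end. Hence no connector
    is empty, and two vertices of [V0] are consecutive only where they are adjacent. *)
Lemma sorted_connect_breaks v s ex :
  0 < m -> m * (breaks v s).+1 <= size ex ->
  sorted adj_sum (connect_breaks v s ex).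
Proof.
move=> m_gt0.
have inr_path a (l : seq X) t : sorted adj_sum t -> 0 < size l ->
    path adj_sum a (map inr l ++ t).
  move=> Ht; case: l => // e l _ /=; apply/andP; split; first by case: a.
  by elim: l e => [|e' l IHl] e /=; [case: t Ht | apply: IHl].
elim: s v ex => [|w s IH] v ex /= Hsz.
  rewrite -[map inr ex]cats0; apply: inr_path => //.
  by apply: leq_trans Hsz; rewrite muln_gt0 m_gt0.
have [vw|vw] := boolP (adj v w); rewrite /= vw in Hsz *.
  have [t Et] : exists t, connect_breaks w s ex = inl w :: t.
    by case: (s) => [|u s'] /=; [|case: (adj w u)]; eexists.
  by have := IH w ex Hsz; rewrite Et /= vw.
apply: inr_path; last first.
  by rewrite size_take_min leq_min m_gt0; apply: leq_trans Hsz; rewrite muln_gt0 m_gt0.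
apply: IH; rewrite size_drop leq_subRL; first by rewrite -mulnS.
by apply: leq_trans Hsz; rewrite mulnS leq_addr.
Qed.

Section Closure.
Variable Z : seq (V0 + X).

(* The vertex set of a cycle has this property at consecutive [a] and [b], since
   a connector vertex has degree 2. *)
Definition closed_at (a b : V0 + X) : bool :=
  ((~~ is_inl a && (a \in Z)) ==> (b \in Z)) &&
  ((~~ is_inl b && (b \in Z)) ==> (a \in Z)).

(** Membership in [Z] spreads from one vertex of the run forwards to its end and backwards to the
    vertex [a] in front of it. *)
Lemma closed_run a ex t e :
  path closed_at a (map inr ex ++ t) -> e \in ex -> inr e \in Z ->
  all (mem Z) (a :: map inr ex).
Proof.
have fwd e' l : path closed_at (inr e') (map inr l ++ t) -> inr e' \in Z ->
    all (mem Z) (map inr l).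
  elim: l e' => [|f l IH] e' //= /andP[/andP[+ _] Hl] He'.
  by rewrite He' /= => Hf; rewrite Hf /=; apply: IH Hf.
elim: ex a => [|f ex IH] a //= /andP[/andP[_ bwd] Hex].
rewrite inE => /orP[/eqP->|eex] eZ.
  by rewrite eZ /= in bwd; rewrite bwd eZ (fwd f).
have /= /andP[fZ exZ] := IH _ Hex eex eZ.
by rewrite fZ /= in bwd; rewrite bwd fZ.
Qed.

(* A connector meeting [Z] lies in [Z] together with the vertex before it,
   which makes m + 1 elements. *)
Lemma connectors_avoid v s ex :
  size Z <= m -> uniq (connect_breaks v s ex) ->
  m * (breaks v s).+1 <= size ex -> sorted closed_at (connect_breaks v s ex) ->
  forall e, e \in ex -> inr e \notin Z.
Proof.
move=> Zm.
have run a l t e : m <= size l -> uniq (a :: map inr l) ->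
    path closed_at a (map inr l ++ t) -> e \in l -> inr e \notin Z.
  move=> lm Ul Hl el; apply/negP => /(closed_run Hl el)/allP aZ.
  have := uniq_leq_size Ul aZ; rewrite /= size_map => H.
  by have := leq_trans (leq_trans H Zm) lm; rewrite ltnn.
elim: s v ex => [|w s IH] v ex U Hsz Hs e eex.
  rewrite muln1 in Hsz; apply: (run (inl v) ex [::] e) => //.
  by rewrite cats0.
move: U Hsz Hs => /=; case: (adj v w) => /= [/andP[_ U] Hsz Hs|U Hsz Hs].
  by apply: (IH w ex) => //; apply: path_sorted Hs.
have mex : m <= size ex by apply: leq_trans Hsz; rewrite mulnS leq_addr.
move: eex; rewrite -[X in e \in X](cat_take_drop m ex) mem_cat => /orP[eex|eex].
  apply: (run _ (take m ex) _ e _ _ Hs eex); first by rewrite size_takel.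
  by move: U; rewrite -/(uniq (_ :: _)) -cat_cons cat_uniq => /andP[].
apply: (IH w (drop m ex)) => //.
- by move: U => /andP[_]; rewrite cat_uniq => /and3P[].
- by rewrite size_drop leq_subRL // -mulnS.
- have := path_sorted Hs.
  by elim: (map _ _) => [|? l IHl] //= /path_sorted.
Qed.

End Closure.
End Connectors.

Lemma inl_inj {A B : Type} : injective (@inl A B).
Proof. by move=> ? ? []. Qed.

Lemma inr_inj {A B : Type} : injective (@inr A B).
Proof. by move=> ? ? []. Qed.

Section Union.
Variables (V0 X : finType) (adj : rel V0) (m : nat).
Hypotheses (m_gt2 : 2 < m) (adj_sym : symmetric adj).
Hypothesis adj_free : forall z, uniq z -> size z = m -> ~~ cycle adj z.

(** An extra vertex has the same neighbours in both paths, so a cycle through it contains both of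
    them, and [connectors_avoid] keeps such vertices off a cycle of length m. What remains is a
    cycle of [adj]. *)
Lemma connected_union_free (v v' : V0) (s s' : seq V0) (ex : seq X) z
    (c := connect_breaks adj m v s ex) (c' := connect_breaks adj m v' s' ex) :
  (forall e, e \in ex) -> uniq c -> uniq c' ->
  m * (breaks adj v s).+1 <= size ex -> m * (breaks adj v' s').+1 <= size ex ->
  (forall e, next c (inr e) = next c' (inr e)) ->
  (forall e, prev c (inr e) = prev c' (inr e)) ->
  uniq z -> size z = m ->
  ~~ cycle (fun a b => consecutive c a b || consecutive c' a b) z.
Proof.
move=> exT Uc Uc' b_ex b'_ex En Ep Uz zm; apply/negP => Cz.
have m_gt0 : 0 < m by apply: leq_trans m_gt2.
have nbr e b : consecutive c (inr e) b || consecutive c' (inr e) b ->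
    b = next c (inr e) \/ b = prev c (inr e).
  by case/orP => /consecutiveP; rewrite -?En -?Ep; apply.
(* As m > 2, the successor and predecessor on [z] are distinct, so they exhaust the two candidates
   given by [nbr]. *)
have clos e : inr e \in z -> (next c (inr e) \in z) && (prev c (inr e) \in z).
  move=> ez; have := next_neq_prev Uz; rewrite zm => /(_ _ m_gt2 ez).
  have: consecutive c (inr e) (prev z (inr e)) || consecutive c' (inr e) (prev z (inr e)).
    by rewrite 2!(consecutive_sym _ (inr e)); exact: prev_cycle Cz ez.
  have nz : next z (inr e) \in z by rewrite mem_next.
  have pz : prev z (inr e) \in z by rewrite mem_prev.
  move: (next_cycle Cz ez) => /nbr[] E1 /nbr[] E2; rewrite E1 E2 ?eqxx //.
    by rewrite -E1 -E2 nz pz.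
  by rewrite -E1 -E2 nz pz.
have z_inl e : inr e \notin z.
  apply: (connectors_avoid (adj := adj) (m := m) (Z := z) (v := v) (s := s) (ex := ex)) => //.
    by rewrite zm.
  apply: sorted_zip => a b ab; rewrite /closed_at; apply/andP.
  split; apply/implyP => /andP[]; [case: a ab | case: b ab] => //= e1 ab _ /clos/andP[].
    by rewrite (next_zip Uc ab).
  by rewrite (prev_zip Uc ab).
have [z0 Ez] : exists z0, z = map inl z0.
  elim: (z) z_inl => [|a z' IH] H; first by exists [::].
  have [e|z0 ->] := IH; first by have := H e; rewrite inE negb_or => /andP[].
  case: a H => [a|e] H; first by exists (a :: z0).
  by have := H e; rewrite inE eqxx.
have z0_adj : cycle adj z0.
  have: cycle (fun a b => consecutive c a b || consecutive c' a b) (map inl z0).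
    by rewrite -Ez.
  rewrite /= (cycle_map); apply: sub_cycle => a b /=.
  have key v1 s1 : m * (breaks adj v1 s1).+1 <= size ex ->
    consecutive (connect_breaks adj m v1 s1 ex) (inl a) (inl b) -> adj a b.
    move=> /(sorted_connect_breaks m_gt0)/zip_sorted Hs.
    by rewrite adj_sym; case/orP => /Hs //=; rewrite adj_sym.
  by case/orP; apply: key.
have := adj_free _ _ ; move=> /(_ z0); rewrite z0_adj.
by rewrite Ez size_map map_inj_uniq in zm Uz => [|? ? []] //; move=> /(_ Uz zm).
Qed.

End Union.

(** * Bounding a family by a set of conflict-free paths *)

Definition seq_breaks (V : finType) (adj : rel V) (s : seq V) :=
  if s is v :: s' then breaks adj v s' else 0.

(** A pair of a member E and an index i is encoded by the vertex bijection that carries path i to E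
    and by the neighbours of the extra vertices on path i. The encoding is injective, and its two
    components account for the factors n^n and (n^2)^x. *)
Lemma H_cycle_coclique (V0 : finType) (adj : rel V0) (m b x : nat)
    (I : finType) (s : I -> seq V0) (n := #|V0| + x) :
  2 < m -> symmetric adj ->
  (forall z, uniq z -> size z = m -> ~~ cycle adj z) ->
  0 < #|V0| -> injective s -> (forall i, uniq (s i)) ->
  (forall i, size (s i) = #|V0|) -> (forall i, seq_breaks adj (s i) <= b) ->
  m * b.+1 <= x ->
  H_cycle n m * #|I| <= n ^ n * (n ^ 2) ^ x.
Proof.
move=> m_gt2 adj_sym adj_free V0_gt0 s_inj Us size_s s_b b_x.
apply: (@leq_trans (#|{ffun V0 + 'I_x -> 'I_n}| *
                    #|{ffun 'I_x -> (V0 + 'I_x) * (V0 + 'I_x)}|)); last first.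
  by rewrite !card_ffun card_prod card_sum !card_ord.
pose ex := enum 'I_x.
pose c i := if s i is v :: s' then connect_breaks adj m v s' ex else [::].
have c_cons i : exists v s', [/\ s i = v :: s', c i = connect_breaks adj m v s' ex &
     breaks adj v s' <= b].
  have := size_s i; have := s_b i; rewrite /c; case: (s i) => [_ E|v s' sb _].
    by rewrite -E in V0_gt0.
  by exists v, s'.
have c_perm i : perm_eq (c i) (map inl (s i) ++ map inr ex).
  by have [v [s' [-> -> _]]] := c_cons i; apply: perm_connect_breaks.
have Uc i : uniq (c i).
  rewrite (perm_uniq (c_perm i)) cat_uniq (map_inj_uniq inl_inj) (map_inj_uniq inr_inj).
  rewrite Us enum_uniq andbT; apply/hasPn => _ /mapP[e _ ->].
  by apply/negP => /mapP[].
have size_c i : size (c i) = n.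
  by rewrite (perm_size (c_perm i)) size_cat !size_map size_s -enumT size_enum_ord.
have mem_c i a : a \in c i.
  rewrite (perm_mem (c_perm i)) mem_cat; case: a => [a|e].
    rewrite mem_map; last by move=> ? ? [].
    suff -> : a \in s i by [].
    have /esym := card_uniqP (Us i); rewrite size_s => E.
    by have /subset_cardP/(_ (subset_predT _)) -> : #|s i| = #|V0| by [].
  by rewrite (mem_map (f := inr)) ?mem_enum ?orbT // => ? ? [].
have c_inj : injective c.
  move=> i j; have [v [s1 [Ei -> _]]] := c_cons i; have [w [s2 [Ej -> _]]] := c_cons j.
  move=> /(congr1 (filter (@is_inl _ _))); rewrite !filter_connect_breaks -Ei -Ej.
  by move=> /inj_map E; apply: s_inj; apply: E => ? ? [].
have cardV : #|{: V0 + 'I_x}| = n by rewrite card_sum card_ord.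
rewrite /H_cycle.
have [F FP ->] : {F : {set {set {set 'I_n}}} | Cm_family m F &
    \max_(F : {set {set {set 'I_n}}} | Cm_family m F) #|F| = #|F|}.
  apply: eq_bigmax_cond; apply/card_gt0P; exists set0.
  by apply/andP; split; apply/forall_inP => E; rewrite in_set0.
have /andP[/forallP Fham /forallP Fcyc] := FP.
have n_gt0 : 0 < n by rewrite addn_gt0 V0_gt0.
pose o : 'I_n := Ordinal n_gt0.
(* The empty sequence is a dummy value: every member of [F] is a Hamilton path. *)
pose path (E : {set {set 'I_n}}) : seq 'I_n :=
  oapp val [::] [pick p : n.-tuple 'I_n | uniq p && (E == path_edges p)].
have pathP E : E \in F -> [/\ uniq (path E), size (path E) = n & E = path_edges (path E)].
  move=> EF; have := Fham E; rewrite EF /= => /existsP[p pP].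
  rewrite /path; case: pickP => [q /andP[Uq /eqP Eq]|/(_ p)]; last by rewrite pP.
  by rewrite /= size_tuple.
pose tau E i : {ffun V0 + 'I_x -> 'I_n} := [ffun v => nth o (path E) (index v (c i))].
have tauP E i : E \in F -> map (tau E i) (c i) = path E.
  case/pathP=> _ sz _; apply: (@eq_from_nth _ o); rewrite size_map size_c ?sz // => k kn.
  have [v0] : exists v0, v0 \in c i.
    by case: (c i) (size_c i) => [/= E0|v0 l _]; [rewrite -E0 in kn | exists v0; rewrite mem_head].
  move=> _; rewrite (nth_map v0) ?size_c // ffunE index_uniq ?size_c //.
have tau_inj E i : E \in F -> injective (tau E i).
  move=> EF u w; rewrite !ffunE => /eqP; have [Up sz _] := pathP E EF.
  rewrite nth_uniq ?sz -?(size_c i) ?index_mem // => /eqP.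
  by move=> /(congr1 (nth u (c i))); rewrite !nth_index.
pose code (i : I) : {ffun 'I_x -> (V0 + 'I_x) * (V0 + 'I_x)} :=
  [ffun e => (next (c i) (inr e), prev (c i) (inr e))].
pose f (Ei : {set {set 'I_n}} * I) := (tau Ei.1 Ei.2, code Ei.2).
rewrite -card_prod -cardsT -cardsX.
have f_inj : {in setX F [set: I] &, injective f}.
  move=> [E i] [E' j]; rewrite !inE !andbT /= => EF E'F [Et Ec].
  have ti := tauP E i EF; have tj := tauP E' j E'F.
  (* Otherwise the C_m in the union of E and E' pulls back along the common bijection to the union
     of paths i and j, whose extra vertices have equal neighbours. *)
  have EE : E = E'.
    apply/eqP/negPn/negP => neqE; have := Fcyc E; rewrite EF /= => /forallP/(_ E').
    rewrite E'F neqE /= => /existsP[z /andP[Uz Cz]].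
    have [g fg gf] : bijective (tau E i).
      by apply: inj_card_bij; [apply: tau_inj | rewrite cardV card_ord].
    have Ez : map (tau E i) (map g z) = z by rewrite -map_comp map_id_in // => y _; apply: gf.
    have Ugz : uniq (map g z) by rewrite (map_inj_uniq (can_inj gf)).
    have [_ _ PE] := pathP E EF; have [_ _ PE'] := pathP E' E'F.
    have sz : size (map g z) = m by rewrite size_map size_tuple.
    have := Cz; rewrite -{1}Ez {1}PE {1}PE' -ti -tj -Et.
    move=> /(cycle_map_consecutive (tau_inj E i EF) Ugz); rewrite sz ltnW // => /(_ isT).
    apply/negP; move: (Uc i) (Uc j) => Ui Uj.
    have np e : next (c i) (inr e) = next (c j) (inr e) /\
                prev (c i) (inr e) = prev (c j) (inr e).
      by move/ffunP: Ec => /(_ e); rewrite !ffunE => -[].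
    have [v [s1 [_ Ei b1]]] := c_cons i; have [w [s2 [_ Ej b2]]] := c_cons j.
    rewrite Ei Ej in np Ui Uj *.
    apply: connected_union_free => //; try by move=> e; have [] := np e.
    - by move=> e; rewrite mem_enum.
    - by rewrite size_enum_ord; apply: leq_trans b_x; rewrite leq_mul2l ltnS b1 orbT.
    - by rewrite size_enum_ord; apply: leq_trans b_x; rewrite leq_mul2l ltnS b2 orbT.
  have Ei : c i = c j.
    by apply: (inj_map (tau_inj E i EF)); rewrite ti Et tj EE.
  by rewrite EE (c_inj _ _ Ei).
rewrite -(card_in_imset f_inj) -cardsT; apply: subset_leq_card; exact: subsetT.
Qed.

(** * Greedy paths in a bipartite graph *)

Section Greedy.
Variables (W : finType) (a : rel W).

(** The Boolean is the side: [false] for first arguments of [a], [true] for second ones. *)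
Definition bip : rel (bool * W) :=
  fun x y => if x.1 then ~~ y.1 && a y.2 x.2 else y.1 && a x.2 y.2.

Lemma bip_sym : symmetric bip.
Proof. by move=> [[] x] [[] y]. Qed.

Lemma bip_side x y : bip x y -> y.1 = ~~ x.1.
Proof. by case: x y => [[] x] [[] y]. Qed.

Variables (N' d : nat).
Local Notation N := #|W|.
Hypotheses (d_N' : d <= N') (N'_N : N' <= N).
Hypothesis few_bad_left : forall U : {set W}, N' <= #|U| ->
  #|[set l | #|[set r in U | a l r]| < d]| <= N'.
Hypothesis few_bad_right : forall U : {set W}, N' <= #|U| ->
  #|[set r | #|[set l in U | a l r]| < d]| <= N'.

Definition free_nbrs (s : seq (bool * W)) x := [set y | (y \notin s) && bip x y].

(* Sequences are built from the last vertex to the first one: [head s] is the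
   current end of the path. *)
Definition nexts (s : seq (bool * W)) : {set bool * W} :=
  if s is x :: _ then
    if d <= #|free_nbrs s x| then free_nbrs s x
    else [set y | (y \notin s) && (y.1 != x.1)]
  else [set y | ~~ y.1].

Fixpoint greedy t : seq (seq (bool * W)) :=
  if t is t'.+1 then [seq y :: s | s <- greedy t', y <- enum (nexts s)]
  else [:: [::]].

Lemma greedy_uniq t : uniq (greedy t).
Proof.
elim: t => //= t IH; apply: allpairs_uniq_dep => //; first by move=> s _; apply: enum_uniq.
by move=> [s y] [s' y'] _ _ /= [-> ->].
Qed.

(** The first vertex is on the left and every step, jumps included, changes side; parity then fixes
    the counts. *)
Lemma greedyP t s : s \in greedy t ->
  [/\ size s = t, uniq s, count (fun x => x.1 == true) s = t./2,
      count (fun x => x.1 == false) s = uphalf t &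
      if s is x :: _ then x.1 = ~~ odd t else True].
Proof.
elim: t s => [|t IH] s /=; first by rewrite inE => /eqP->.
case/allpairsPdep => s' [y [/IH[sz Us cR cL hd]]]; rewrite mem_enum => yn ->.
have [ys' y1] : y \notin s' /\ y.1 = odd t.
  move: yn; rewrite /nexts; case: s' sz hd {Us cR cL} => [<- _|x s' _ hd].
    by rewrite inE => /negbTE.
  case: ifP => _; rewrite in_set => /andP[-> yx]; split=> //.
    by rewrite (bip_side yx) hd negbK.
  by move: yx; rewrite hd; case: (y.1); case: (odd t).
rewrite /= sz ys' Us cR cL y1; split=> //; rewrite ?negbK //.
  by case E: (odd t); rewrite uphalf_half E.
by case E: (odd t); rewrite uphalf_half E.
Qed.

Definition unvisited b (s : seq (bool * W)) := [set w | (b, w) \notin s].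

Lemma card_unvisited b s :
  uniq s -> #|unvisited b s| = N - count (fun x => x.1 == b) s.
Proof.
move=> Us; rewrite -(cardsC (unvisited b s)) addnC.
suff -> : #|~: unvisited b s| = count (fun x => x.1 == b) s by rewrite addKn.
rewrite -size_filter -(size_map snd) -(card_uniqP _).
  apply: eq_card => w; rewrite !inE negbK; apply/idP/mapP.
    by move=> bw; exists (b, w) => //; rewrite mem_filter /= eqxx.
  by case=> -[b' w']; rewrite mem_filter /= => /andP[/eqP-> ?] ->.
rewrite map_inj_in_uniq ?filter_uniq // => -[b1 w1] [b2 w2].
by rewrite !mem_filter /= => /andP[/eqP-> _] /andP[/eqP-> _] ->.
Qed.

Lemma greedy_unvisited t s b : t <= (N - N').*2 -> s \in greedy t ->
  N' <= #|unvisited b s|.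
Proof.
move=> t_le /greedyP[_ Us cR cL _]; rewrite card_unvisited //.
by case: b; rewrite ?cR ?cL; lia.
Qed.

Lemma size_greedy t : t <= (N - N').*2 -> d ^ t <= size (greedy t).
Proof.
elim: t => // t IH t_lt; rewrite /= size_allpairs_dep.
have {}IH := IH (ltnW t_lt).
apply: leq_trans (_ : \sum_(s <- greedy t) d <= _).
  by rewrite big_const_seq count_predT iter_addn_0 expnS leq_mul2l IH orbT.
rewrite sumnE big_map big_seq [X in _ <= X]big_seq; apply: leq_sum => s sG.
rewrite -cardE; case: s sG => [|x s] sG /=.
  apply: leq_trans (leq_trans d_N' N'_N) _.
  rewrite -(card_imset (f := pair false)); last by move=> ? ? [].
  by apply/subset_leq_card/subsetP => _ /imsetP[w _ ->]; rewrite inE.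
(* A jump may go to any unvisited vertex of the other side, and at least N' >= d of these are
   left. *)
case: ifP => // _; apply: leq_trans d_N' _.
apply: leq_trans (greedy_unvisited (~~ x.1) (ltnW t_lt) sG) _.
rewrite -(card_imset _ (f := pair (~~ x.1))); last by move=> ? ? [].
apply/subset_leq_card/subsetP => _ /imsetP[w + ->].
by rewrite !inE /= => ->; case: x.1.
Qed.

Definition bad s x := #|free_nbrs s x| < d.

(** A jump leaves a vertex that had fewer than d free neighbours at that time. Free neighbours only
    disappear later, so this vertex is still bad for the final sequence. *)
Lemma greedy_breaks_bad t s :
  s \in greedy t -> seq_breaks bip s <= count (bad s) (behead s).
Proof.
elim: t s => [|t IH] s /=; first by rewrite inE => /eqP->.
case/allpairsPdep => s' [y [/IH s'b]]; rewrite mem_enum => yn -> /=.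
have bad_y x : bad s' x -> bad (y :: s') x.
  apply: leq_ltn_trans; apply/subset_leq_card/subsetP => z.
  by rewrite !inE negb_or -andbA => /and3P[_ -> ->].
case: s' s'b yn bad_y => [|x s'] //= s'b yn bad_y.
apply: leq_add; last by apply: leq_trans s'b _; apply: sub_count.
case: (boolP (bip y x)) => //= yx; rewrite lt0b; apply: bad_y.
move: yn; rewrite /bad; case: leqP => //= _.
by rewrite inE bip_sym (negbTE yx) andbF.
Qed.

(** Breaks are charged to bad vertices. At the end N' vertices of each side are unvisited, so the
    hypotheses, applied to these two sets, leave at most N' bad vertices on either side. *)
Lemma greedy_breaks s : s \in greedy (N - N').*2 -> seq_breaks bip s <= N'.*2.
Proof.
move=> sG; apply: leq_trans (greedy_breaks_bad sG) _.
have [_ Us _ _ _] := greedyP sG.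
have Ubs : uniq (behead s) by case: s Us {sG} => //= ? ? /andP[].
rewrite -size_filter -(card_uniqP (filter_uniq _ Ubs)).
apply: leq_trans (_ : #|[set x | bad s x]| <= _).
  by apply/subset_leq_card/subsetP => x; rewrite mem_filter inE => /andP[].
pose B b := [set w | bad s (b, w)].
have -> : #|[set x | bad s x]| = #|B true| + #|B false|.
  rewrite -(cardsID [set x : bool * W | x.1]); congr (_ + _).
    rewrite -(card_imset (B true) (f := pair true)); last by move=> ? ? [].
    apply: eq_card => -[b w]; rewrite !inE; apply/andP/imsetP => [[]|].
      by case: b => // bw _; exists w; rewrite ?inE.
    by case=> w' + [-> ->]; rewrite inE.
  rewrite -(card_imset (B false) (f := pair false)); last by move=> ? ? [].
  apply: eq_card => -[b w]; rewrite !inE; apply/andP/imsetP => [[]|].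
    by case: b => // _ bw; exists w; rewrite ?inE.
  by case=> w' + [-> ->]; rewrite inE.
have free_card b w : #|free_nbrs s (b, w)| =
    #|[set v in unvisited (~~ b) s | if b then a v w else a w v]|.
  rewrite -[RHS](card_imset _ (f := pair (~~ b))); last by move=> ? ? [].
  apply: eq_card => -[c v]; rewrite !inE /bip /=; apply/idP/imsetP.
    by case: b => /=; case: c => //= /andP[vs wv]; exists v => //; rewrite !inE vs.
  by case=> v' + [-> ->]; rewrite !inE; case: b.
rewrite -addnn; apply: leq_add.
  have := few_bad_right (greedy_unvisited false (leqnn _) sG).
  by congr (_ <= _); apply: eq_card => w; rewrite !inE /bad free_card.
have := few_bad_left (greedy_unvisited true (leqnn _) sG).
by congr (_ <= _); apply: eq_card => w; rewrite !inE /bad free_card.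
Qed.
End Greedy.

(** * Concatenated paths and disjoint copies of a graph *)

Section SeqBreaks.
Variables (V : finType) (adj : rel V).
Implicit Types (s : seq V).

Lemma seq_breaks_cons x s : seq_breaks adj (x :: s) <= (seq_breaks adj s).+1.
Proof. by case: s => //= y s; case: (adj x y); rewrite /= ?ltnS ?leqnn // ltnW. Qed.

Lemma seq_breaks_size s : seq_breaks adj s <= size s.
Proof. by elim: s => // x s IH; apply: leq_trans (seq_breaks_cons _ _) _. Qed.

Lemma seq_breaks_cat s1 s2 :
  seq_breaks adj (s1 ++ s2) <= seq_breaks adj s1 + (seq_breaks adj s2).+1.
Proof.
case: s1 => [|x s1] /=; first by rewrite add0n.
elim: s1 x => [|y s1 IH] x /=; first exact: seq_breaks_cons.
by rewrite -addnA leq_add2l.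
Qed.

Lemma seq_breaks_flatten B (ss : seq (seq V)) :
  (forall s, s \in ss -> seq_breaks adj s <= B) ->
  seq_breaks adj (flatten ss) <= size ss * B.+1.
Proof.
elim: ss => // s ss IH H /=; apply: leq_trans (seq_breaks_cat _ _) _.
rewrite mulSn addSn -addnS leq_add ?H ?mem_head // ltnS IH // => t tss.
by apply: H; rewrite inE tss orbT.
Qed.

End SeqBreaks.

Lemma seq_breaks_map (V V' : finType) (f : V -> V') (adj : rel V) (adj' : rel V') s :
  (forall x y, adj' (f x) (f y) = adj x y) ->
  seq_breaks adj' (map f s) = seq_breaks adj s.
Proof.
move=> H; case: s => //= x s; elim: s x => //= y s IH x.
by rewrite H IH.
Qed.

Section Copies.
Variables (J V : finType) (adj : rel V).

Definition copies : rel (J * V) := fun x y => (x.1 == y.1) && adj x.2 y.2.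

Lemma copies_sym : symmetric adj -> symmetric copies.
Proof. by move=> H x y; rewrite /copies eq_sym H. Qed.

(** A cycle never leaves its copy, so the projection to [V] is injective on it. *)
Lemma copies_free m :
  (forall z, uniq z -> size z = m -> ~~ cycle adj z) ->
  forall z, uniq z -> size z = m -> ~~ cycle copies z.
Proof.
move=> H z Uz zm; apply/negP => Cz.
have Cadj : cycle adj (map snd z).
  by rewrite cycle_map; apply: sub_cycle Cz => x y /andP[].
have [j Ez] : exists j, all (fun x => x.1 == j) z.
  case: z Cz {Cadj} Uz zm => [|x z Cz _ _]; first by move=> _ _ /(H [::] isT).
  exists x.1; move: Cz; rewrite /= eqxx; elim: z {1 3}x (erefl x.1) => //= y z IH w.
  by move=> E /andP[/andP[/eqP wy _]] /(IH y); rewrite -wy E eqxx; apply.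
suff Uz2 : uniq (map snd z) by have := H _ Uz2; rewrite Cadj size_map => /(_ zm).
rewrite map_inj_in_uniq // => -[i u] [i' u'] /(allP Ez)/eqP/= -> /(allP Ez)/eqP/= ->.
by move=> /= ->.
Qed.

End Copies.

(** A greedy path is chosen independently in each of K copies, which gives at least d^(K T) spanning
    sequences with T = 2 (N - N') and N the size of [W]. *)
Lemma H_cycle_greedy (W : finType) (a : rel W) (N' d m K x : nat)
    (n := K * #|W|.*2 + x) :
  2 < m -> 0 < #|W| -> 0 < K -> d <= N' -> N' <= #|W| ->
  (forall z, uniq z -> size z = m -> ~~ cycle (bip a) z) ->
  (forall U : {set W}, N' <= #|U| -> #|[set l | #|[set r in U | a l r]| < d]| <= N') ->
  (forall U : {set W}, N' <= #|U| -> #|[set r | #|[set l in U | a l r]| < d]| <= N') ->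
  m * (K * (N' * 4).+1).+2 <= x ->
  H_cycle n m * d ^ (K * (#|W| - N').*2) <= n ^ n * (n ^ 2) ^ x.
Proof.
move=> m_gt2 W_gt0 K_gt0 d_N' N'_W a_free badL badR x_ge.
set T := (#|W| - N').*2.
pose V := ('I_K * (bool * W))%type; pose adj : rel V := @copies 'I_K _ (bip a).
have cardV : #|{: V}| = K * #|W|.*2 by rewrite !card_prod card_ord card_bool mul2n.
pose I := {ffun 'I_K -> seq_sub (greedy a d T)}.
pose blocks (phi : I) : seq (seq V) :=
  [seq [seq (j, v) | v <- ssval (phi j)] | j <- enum 'I_K].
(* The 2 N' vertices missed in each copy are appended in a fixed order; each may cost a break. *)
pose rest phi : seq V := [seq v <- enum {: V} | v \notin flatten (blocks phi)].
pose s phi := flatten (blocks phi) ++ rest phi.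
have phiP (phi : I) j := greedyP (ssvalP (phi j)).
have shape_blocks phi : shape (blocks phi) = nseq K T.
  rewrite /shape -map_comp (eq_map (g := fun=> T)) => [|j]; last first.
    by rewrite /= size_map; have [] := phiP phi j.
  by rewrite -[in RHS](size_enum_ord K); elim: (enum _) => //= j l ->.
have size_blocks phi : size (flatten (blocks phi)) = K * T.
  by rewrite size_flatten shape_blocks sumn_nseq mulnC.
have U_blocks phi : uniq (flatten (blocks phi)).
  rewrite /blocks; have := enum_uniq 'I_K; elim: (enum _) => //= j l IH /andP[jl Ul].
  rewrite cat_uniq IH // map_inj_uniq; last by move=> ? ? [].
  have [_ -> _ _ _] := phiP phi j; rewrite andbT /=.
  apply/hasPn => y /flatten_mapP[j' j'l /mapP[v _ ->]]; apply/negP => /mapP[v' _ [E _]].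
  by rewrite -E j'l in jl.
have Us phi : uniq (s phi).
  rewrite cat_uniq U_blocks filter_uniq ?enum_uniq // andbT.
  by apply/hasPn => y; rewrite mem_filter => /andP[].
have size_s phi : size (s phi) = #|{: V}|.
  apply/esym; rewrite -(card_uniqP (Us phi)); apply: eq_card => y.
  by rewrite !inE mem_cat mem_filter mem_enum andbT orbN.
have size_rest phi : size (rest phi) = K * (N' * 2).
  have := size_s phi; rewrite size_cat size_blocks cardV /T; nia.
have s_inj : injective s.
  move=> phi psi /eqP; rewrite eqseq_cat ?size_blocks // => /andP[/eqP E _].
  have /eq_in_map H : blocks phi = blocks psi.
    by apply: eq_from_flatten_shape E _; rewrite !shape_blocks.
  apply/ffunP => j; apply: val_inj => /=.
  by have /inj_map := H j (mem_enum _ j); apply => ? ? [].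
(* Each block has at most 2 N' breaks and one junction, the rest adds at most 2 K N', and one more
   junction precedes the rest. *)
have s_breaks phi : seq_breaks adj (s phi) <= (K * (N' * 4).+1).+1.
  apply: leq_trans (seq_breaks_cat _ _ _) _.
  apply: (@leq_trans (K * (N'.*2).+1 + (K * (N' * 2)).+1)); last by nia.
  apply: leq_add; last by rewrite ltnS -(size_rest phi) seq_breaks_size.
  apply: leq_trans (seq_breaks_flatten (B := N'.*2) _) _; last first.
    by rewrite size_map size_enum_ord.
  move=> _ /mapP[j _ ->]; rewrite (seq_breaks_map (adj := bip a)); last first.
    by move=> u v; rewrite /adj /copies eqxx.
  apply: (greedy_breaks d_N' N'_W badL badR); exact: ssvalP.
have V_gt0 : 0 < #|{: V}| by rewrite cardV muln_gt0 K_gt0 double_gt0.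
have := H_cycle_coclique m_gt2 (copies_sym (@bip_sym _ a)) (copies_free a_free)
  V_gt0 s_inj Us size_s s_breaks x_ge.
rewrite cardV -/n; apply: leq_trans; rewrite leq_mul2l; apply/orP; right.
rewrite card_ffun card_ord card_seq_sub ?greedy_uniq // mulnC expnM.
by rewrite leq_exp2r //; apply: size_greedy d_N' N'_W _ (leqnn _).
Qed.

HB.saturate prod.

Section MixingGraphs.
Import ring lra.
Local Open Scope ring_scope.

(** * Mixing *)

(** By Lagrange's identity, the double sum of (f i g j - f j g i)^2 is twice the difference of the
    two sides. *)
Lemma cauchy_schwarz (I : finType) (P : pred I) (f g : I -> rat) :
  (\sum_(i | P i) f i * g i) ^+ 2 <= (\sum_(i | P i) f i ^+ 2) * \sum_(i | P i) g i ^+ 2.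
Proof.
have: 0 <= \sum_(i | P i) \sum_(j | P j) (f i * g j - f j * g i) ^+ 2.
  by do 2![apply: sumr_ge0 => ? _]; apply: sqr_ge0.
have -> : \sum_(i | P i) \sum_(j | P j) (f i * g j - f j * g i) ^+ 2 =
   2 * ((\sum_(i | P i) f i ^+ 2) * \sum_(i | P i) g i ^+ 2) -
   2 * (\sum_(i | P i) f i * g i) ^+ 2.
  have E : \sum_(i | P i) \sum_(j | P j) (f i * g j - f j * g i) ^+ 2 =
   \sum_(i | P i) \sum_(j | P j) (f i ^+ 2 * g j ^+ 2) +
   \sum_(i | P i) \sum_(j | P j) (f j ^+ 2 * g i ^+ 2) -
   2 * \sum_(i | P i) \sum_(j | P j) (f i * g i) * (f j * g j).
    rewrite mulr_sumr -big_split -sumrB /=; apply: eq_bigr => i _.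
    by rewrite mulr_sumr -big_split -sumrB /=; apply: eq_bigr => j _; ring.
  rewrite E [X in _ + X - _]exchange_big /= expr2 !big_distrlr /=; ring.
lra.
Qed.

Section Mixing.
Variables (L R : finType) (a : L -> R -> bool).

(** For a biregular graph this says that the second largest singular value of the biadjacency matrix
    is at most the square root of c. *)
Definition mixing (c : rat) := forall g : L -> rat, \sum_l g l = 0 ->
  \sum_r (\sum_(l | a l r) g l) ^+ 2 <= c * \sum_l g l ^+ 2.

(** With A the biadjacency operator and h = A g, Cauchy-Schwarz gives |h|^4 = (g, A* h)^2 <= |g|^2 c
    |h|^2. *)
Lemma adjoint_bound (c : rat) (g : L -> rat) (h := fun r => \sum_(l | a l r) g l) :
  0 <= c -> \sum_l (\sum_(r | a l r) h r) ^+ 2 <= c * \sum_r h r ^+ 2 ->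
  \sum_r h r ^+ 2 <= c * \sum_l g l ^+ 2.
Proof.
move=> c_ge0 Hh; set X := \sum_r h r ^+ 2 in Hh *; set G := \sum_l g l ^+ 2.
have X_ge0 : 0 <= X by apply: sumr_ge0 => r _; apply: sqr_ge0.
have G_ge0 : 0 <= G by apply: sumr_ge0 => l _; apply: sqr_ge0.
have [->|X_neq0] := eqVneq X 0; first by rewrite mulr_ge0.
have X_gt0 : 0 < X by rewrite lt_def X_neq0.
have EX : X = \sum_l g l * \sum_(r | a l r) h r.
  under [RHS]eq_bigr => l _ do rewrite mulr_sumr big_mkcond.
  rewrite exchange_big; apply: eq_bigr => r _ /=.
  by rewrite -big_mkcond -mulr_suml expr2.
rewrite -(ler_pM2r X_gt0) -expr2 {1}EX.
apply: le_trans (cauchy_schwarz _ _ _) _; rewrite -/G [_ * G]mulrC -mulrA.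
exact: ler_wpM2l.
Qed.

(* [g] is the indicator of [U] minus its mean; a vertex with fewer than [d]
   neighbours in [U] has an image at least [2 * d] below the mean [3 * d]. *)
Lemma few_bad (N' D d c : nat) :
  mixing c%:R -> (forall r, #|[set l | a l r]| = (3 * D * d)%N) ->
  #|L| = (D * N')%N -> (0 < d)%N -> (0 < D)%N -> (0 < N')%N ->
  (c * (9 * D ^ 3) <= 4 * (3 * D * d) ^ 2)%N ->
  forall U : {set L}, (N' <= #|U|)%N ->
  (#|[set r | #|[set l in U | a l r]| < d]| <= N')%N.
Proof.
move=> mix deg cardL d_gt0 D_gt0 N'_gt0 c_le U U_ge; set B := [set r | _].
pose mu : rat := #|U|%:R / #|L|%:R; pose g l : rat := (l \in U)%:R - mu.
have L_gt0 : 0 < #|L|%:R :> rat by rewrite ltr0n cardL muln_gt0 D_gt0.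
have sumU : \sum_l (l \in U)%:R = #|U|%:R :> rat.
  by rewrite -sum1_card natr_sum [RHS]big_mkcond; apply: eq_bigr => l _; case: ifP.
have g0 : \sum_l g l = 0.
  rewrite sumrB sumU sumr_const -[mu *+ _]mulr_natr /mu divfK ?subrr // lt0r_neq0 //.
have mu_ge : D%:R^-1 <= mu.
  rewrite ler_pdivlMr // cardL natrM mulKf ?ler_nat //.
  by rewrite pnatr_eq0 -lt0n.
have g2 : \sum_l g l ^+ 2 <= #|L|%:R.
  have -> : \sum_l g l ^+ 2 = #|U|%:R - #|L|%:R * mu ^+ 2.
    have -> : \sum_l g l ^+ 2 = \sum_l ((1 - 2 * mu) * (l \in U)%:R + mu ^+ 2).
      by apply: eq_bigr => l _; rewrite /g; case: (l \in U) => /=; ring.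
    rewrite big_split /= -mulr_sumr sumU sumr_const -[mu ^+ 2 *+ _]mulr_natl.
    by have -> : #|U|%:R = mu * #|L|%:R; [rewrite /mu divfK // lt0r_neq0 | ring].
  have : #|U|%:R <= #|L|%:R :> rat by rewrite ler_nat max_card.
  have : 0 <= #|L|%:R * mu ^+ 2 by rewrite mulr_ge0 ?sqr_ge0 // ltW.
  lra.
have devB r : r \in B -> 4 * d%:R ^+ 2 <= (\sum_(l | a l r) g l) ^+ 2.
  rewrite inE => rB.
  have -> : \sum_(l | a l r) g l = #|[set l in U | a l r]|%:R - (3 * D * d)%:R * mu.
    rewrite sumrB -(deg r) sumr_const; congr (_ - _); last first.
      by rewrite -[LHS]mulr_natl; congr (_%:R * _); apply: eq_card => l; rewrite !inE.
    rewrite -sum1_card natr_sum [RHS]big_mkcond [LHS]big_mkcond; apply: eq_bigr => l _.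
    by rewrite inE andbC; case: (a l r); case: (l \in U).
  have h1 : #|[set l in U | a l r]|%:R <= d%:R :> rat by rewrite ler_nat ltnW.
  have h2 : 3 * d%:R <= (3 * D * d)%:R * mu.
    have D_neq0 : D%:R != 0 :> rat by rewrite pnatr_eq0 -lt0n.
    have -> : 3 * d%:R = (3 * D * d)%:R * D%:R^-1 :> rat by rewrite !natrM; field.
    by rewrite ler_wpM2l ?ler0n.
  have d_ge0 : 0 <= d%:R :> rat by rewrite ler0n.
  rewrite -[leRHS]sqrrN opprB; set u := _ - _.
  have : 2 * d%:R <= u by rewrite /u; lra.
  nra.
have : #|B|%:R * (4 * d%:R ^+ 2) <= c%:R * #|L|%:R :> rat.
  apply: le_trans (_ : \sum_r (\sum_(l | a l r) g l) ^+ 2 <= _).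
    rewrite [leRHS](bigID (mem B)) /= -[leLHS]addr0; apply: lerD.
      rewrite mulr_natl -sumr_const; exact: ler_sum.
    by apply: sumr_ge0 => r _; apply: sqr_ge0.
  apply: le_trans (mix g g0) _; by rewrite ler_wpM2l.
rewrite cardL -natrX -!natrM ler_nat => B_le.
(* The hypothesis [c_le] is c D <= 4 d^2 multiplied by 9 D^2, so the comparison is made after the
   same multiplication. *)
have D2d : (0 < 4 * d ^ 2 * (9 * D ^ 2))%N by rewrite !muln_gt0 ?expn_gt0 d_gt0 D_gt0.
rewrite -(leq_pmul2r D2d).
have -> : (N' * (4 * d ^ 2 * (9 * D ^ 2)) = 4 * (3 * D * d) ^ 2 * N')%N by ring.
apply: (@leq_trans (c * (9 * D ^ 3) * N')); last by rewrite leq_mul2r c_le orbT.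
rewrite (_ : _ * _ = #|B| * (4 * d ^ 2) * (9 * D ^ 2))%N; last by ring.
rewrite (_ : c * _ * _ = c * (D * N') * (9 * D ^ 2))%N; last by ring.
by rewrite leq_mul2r B_le orbT.
Qed.

End Mixing.

(** An operator and its adjoint have the same norm; regularity makes the adjoint preserve mean zero,
    so [mix] applies to the image. *)
Lemma mixing_transpose (L R : finType) (a : L -> R -> bool) (c k : nat) :
  mixing a c%:R -> (forall r, #|[set l | a l r]| = k) ->
  mixing (fun r l => a l r) c%:R.
Proof.
move=> mix deg g g0; apply: (adjoint_bound (a := fun r l => a l r)) => //.
apply: mix; under eq_bigr => l _ do rewrite big_mkcond.
rewrite exchange_big /= (eq_bigr (fun r => g r *+ k)) ?sumrMnl ?g0 ?mul0rn // => r _.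
rewrite -big_mkcond sumr_const -(deg r); congr (_ *+ _).
by apply: eq_card => l; rewrite !inE.
Qed.

(** * Lifts of complete bipartite graphs *)

Section Lift.
Variables (F : finFieldType) (V : finZmodType) (f : F -> F -> V).

(** A voltage lift with group [V]: a neighbour of a given vertex is determined by its first
    coordinate, which is arbitrary. *)
Definition ab_lift : rel (F * V) := fun l r => l.2 + r.2 == f l.1 r.1.

Lemma lift_sum_left (g : F * V -> rat) x v :
  \sum_(l | ab_lift l (x, v)) g l = \sum_p g (p, f p x - v).
Proof.
rewrite (reindex_onto (fun p => (p, f p x - v)) fst) => [|[p u] /eqP /= H]; last first.
  by rewrite /= -H addrK.
by apply: eq_bigl => p; rewrite /ab_lift /= subrK !eqxx.
Qed.

Lemma lift_sum_right (h : F * V -> rat) p u :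
  \sum_(r | ab_lift (p, u) r) h r = \sum_x h (x, f p x - u).
Proof.
rewrite (reindex_onto (fun x => (x, f p x - u)) fst) => [|[x v] /eqP /= H]; last first.
  by rewrite /= -H addrC addKr.
by apply: eq_bigl => x; rewrite /ab_lift /= addrC subrK !eqxx.
Qed.

Lemma card_lift_left r : #|[set l | ab_lift l r]| = #|F|.
Proof.
case: r => x v; rewrite -(card_imset _ (f := fun p => (p, f p x - v))) => [|? ? []] //.
apply: eq_card => -[p u]; rewrite !inE /ab_lift /=; apply/eqP/imsetP => [H|[t _ [-> ->]]].
  by exists p; rewrite // -H addrK.
by rewrite subrK.
Qed.

Lemma card_lift_right l : #|[set r | ab_lift l r]| = #|F|.
Proof.
case: l => p u; rewrite -(card_imset _ (f := fun x => (x, f p x - u))) => [|? ? []] //.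
apply: eq_card => -[x v]; rewrite !inE /ab_lift /=; apply/eqP/imsetP => [H|[t _ [-> ->]]].
  by exists x; rewrite // -H addrC addKr.
by rewrite addrC subrK.
Qed.

End Lift.

(** * Spectral bound for the Wenger graphs *)

Section Wenger.
Variables (F : finFieldType) (d : nat).
Local Notation E := (F * 'rV[F]_d)%type.
Local Notation q := #|F|.

Definition moment (x : F) : 'rV[F]_d := \row_j x ^+ j.+1.

Definition wenger : rel E := ab_lift (fun p x => p *: moment x).

Implicit Types (f g h : {ffun E -> rat^o}) (x y t : F) (l : E).

Definition shift x t l : E := (l.1 + t, l.2 + t *: moment x).

(** The neighbours of a right vertex (x, v) form a line of F^(d+1) in direction (1, x, ..., x^d),
    and [lsum x] sums over the lines of this direction. Divided by q, these operators are commuting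
    orthogonal projections. *)
Definition lsum x g : {ffun E -> rat^o} := [ffun l => \sum_t g (shift x t l)].

Definition ip g h : rat := \sum_l g l * h l.

Lemma shiftD x s t l : shift x s (shift x t l) = shift x (t + s) l.
Proof. by rewrite /shift /= -!addrA scalerDl. Qed.

Lemma shiftC x y s t l : shift x s (shift y t l) = shift y t (shift x s l).
Proof. by rewrite /shift /=; congr pair; rewrite addrAC. Qed.

Lemma shift_bij x t : bijective (shift x t).
Proof.
exists (shift x (- t)) => l; rewrite shiftD ?subrr ?addNr /shift;
by rewrite scale0r !addr0; case: l.
Qed.

Lemma lsum_shift x t g l : lsum x g (shift x t l) = lsum x g l.
Proof.
rewrite !ffunE (reindex_inj (addrI (- t))) /=.
by apply: eq_bigr => s _; rewrite shiftD addNKr.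
Qed.

Lemma lsumC x y g : lsum x (lsum y g) = lsum y (lsum x g).
Proof.
apply/ffunP => l; rewrite !ffunE.
under eq_bigr => t _ do rewrite ffunE.
under [RHS]eq_bigr => t _ do rewrite ffunE.
by rewrite exchange_big; do 2!apply: eq_bigr => ? _; rewrite shiftC.
Qed.

Lemma lsumK x g : lsum x (lsum x g) = q%:R *: lsum x g.
Proof.
apply/ffunP => l; rewrite [LHS]ffunE [RHS]ffunE.
under eq_bigr => t _ do rewrite lsum_shift.
by rewrite sumr_const scaler_nat.
Qed.

Lemma lsumB x g h : lsum x (g - h) = lsum x g - lsum x h.
Proof.
by apply/ffunP => l; rewrite !ffunE -sumrB; apply: eq_bigr => t _; rewrite !ffunE.
Qed.

Lemma lsum0 x : lsum x 0 = 0.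
Proof. by rewrite -{1}(subrr 0) lsumB subrr. Qed.

Lemma lsumZ x (k : rat) g : lsum x (k *: g) = k *: lsum x g.
Proof.
by apply/ffunP => l; rewrite !ffunE scaler_sumr; apply: eq_bigr => t _; rewrite !ffunE.
Qed.

Lemma ip_lsum x g h : ip (lsum x g) h = ip g (lsum x h).
Proof.
rewrite /ip; under eq_bigr => l _ do rewrite ffunE mulr_suml.
under [RHS]eq_bigr => l _ do rewrite ffunE mulr_sumr.
rewrite exchange_big [RHS]exchange_big /= (reindex_inj oppr_inj) /=.
apply: eq_bigr => t _; rewrite (reindex _ (onW_bij _ (shift_bij x t))) /=.
apply: eq_bigr => l _; rewrite shiftD addrN; congr (g _ * _).
by case: l => ? ?; rewrite /shift /= scale0r !addr0.
Qed.

Lemma ipC g h : ip g h = ip h g.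
Proof. by apply: eq_bigr => l _; rewrite mulrC. Qed.

Lemma ipDl f g h : ip (f + g) h = ip f h + ip g h.
Proof. by rewrite -big_split; apply: eq_bigr => l _; rewrite ffunE mulrDl. Qed.

Lemma ipDr f g h : ip f (g + h) = ip f g + ip f h.
Proof. by rewrite ipC ipDl !(ipC f). Qed.

Lemma ip0r g : ip g 0 = 0.
Proof. by apply: big1 => l _; rewrite ffunE mulr0. Qed.

Lemma ipZl (k : rat) g h : ip (k *: g) h = k * ip g h.
Proof. by rewrite mulr_sumr; apply: eq_bigr => l _; rewrite ffunE -[k *: g l]/(k * g l) mulrA. Qed.

Lemma ip_ge0 g : 0 <= ip g g.
Proof. by apply: sumr_ge0 => l _; rewrite -expr2 sqr_ge0. Qed.

(** By Vandermonde the d + 1 directions (1, y, ..., y^d) form a basis of F^(d+1); the weights [t]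
    are the coordinates of the difference of the two points. *)
Lemma moment_span (ys : seq F) (l l' : E) : uniq ys -> size ys = d.+1 ->
  exists t : F -> F, l' = (l.1 + \sum_(y <- ys) t y, l.2 + \sum_(y <- ys) t y *: moment y).
Proof.
move=> Uys sz; pose a : 'rV[F]_d.+1 := \row_j ys`_j.
pose V := Vandermonde d.+1 a.
have VU : V \in unitmx.
  rewrite unitmxE det_Vandermonde unitfE; apply/prodf_neq0 => i _; apply/prodf_neq0 => j ij.
  by rewrite !mxE subr_eq0 nth_uniq ?sz // gtn_eqF.
pose b : 'cV[F]_d.+1 := \col_i (if unlift 0 i is Some j then (l'.2 - l.2) 0 j else l'.1 - l.1).
pose s := invmx V *m b.
have Vs : V *m s = b by rewrite mulmxA mulmxV // mul1mx.
exists (fun y => s (inord (index y ys)) 0).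
have sumE (G : F -> F -> F) : \sum_(y <- ys) G (s (inord (index y ys)) 0) y =
    \sum_(i < d.+1) G (s i 0) (a 0 i).
  rewrite (big_nth 0) sz big_mkord; apply: eq_bigr => i _.
  by rewrite index_uniq ?sz // inord_val [a 0 i]mxE.
have Vi i : b i 0 = \sum_(y <- ys) s (inord (index y ys)) 0 * y ^+ i.
  rewrite (sumE (fun u y => u * y ^+ i)) -Vs mxE; apply: eq_bigr => j _.
  by rewrite !mxE mulrC.
case: l' @b s Vs sumE Vi => p' u' b s Vs sumE Vi; congr pair.
  have := Vi 0; rewrite mxE unlift_none /= => E0.
  under eq_bigr => y _ do rewrite -[s _ _]mulr1 -(expr0 y).
  by rewrite -E0 addrC subrK.
apply/rowP => j; have := Vi (lift 0 j); rewrite mxE liftK /= => Ej.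
rewrite !mxE summxE; under eq_bigr => y _ do rewrite !mxE.
by rewrite -[X in _ = _ + X]Ej !mxE [RHS]addrC subrK.
Qed.

(** An eigenvector for q is invariant along the lines of its direction. With d + 1 directions the
    function is constant, hence zero as its sum vanishes. *)
Lemma lsum_eigen_const (ys : seq F) g : uniq ys -> (d < size ys)%N ->
  {in ys, forall y, lsum y g = q%:R *: g} -> \sum_l g l = 0 -> g = 0.
Proof.
have q_neq0 : q%:R != 0 :> rat by rewrite pnatr_eq0 -lt0n; apply/card_gt0P; exists 0.
move=> Uys; rewrite -(cat_take_drop d.+1 ys) in Uys *; set zs := take _ _ in Uys *.
move=> sz Hys.
have size_zs : size zs = d.+1 by rewrite size_takel // -(cat_take_drop d.+1 ys).
have {Uys} Uzs : uniq zs by move: Uys; rewrite cat_uniq => /andP[].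
have {Hys} inv y t l : y \in zs -> g (shift y t l) = g l.
  move=> yzs; have Hy : lsum y g = q%:R *: g by apply: Hys; rewrite mem_cat yzs.
  by apply: (mulfI q_neq0); have := lsum_shift y t g l; rewrite Hy !ffunE.
have const l l' : g l' = g l.
  have [t ->] := moment_span l l' Uzs size_zs.
  elim: (zs) inv l => [|y s IH] inv l; first by rewrite !big_nil !addr0; case: l.
  rewrite !big_cons !addrA -(inv y (t y) l (mem_head _ _)).
  by rewrite -(IH _ (shift y (t y) l)) // => z s' l'' zs'; apply: inv; rewrite inE zs' orbT.
move=> sum0; apply/ffunP => l; rewrite ffunE; apply/eqP.
have := sum0; rewrite (eq_bigr (fun=> g l)) => [|l' _]; last exact: const.
rewrite sumr_const => /eqP; rewrite mulrn_eq0 => /orP[|//].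
by move=> /eqP/card0_eq/(_ l); rewrite inE.
Qed.

(* With [p] the average of [g] along the direction [x], the quadratic forms
   [ip g (lsum y g)] split as a sum over [p] and [g - p]; the first part is
   constant in one more direction, and d + 1 directions span the space. *)
Lemma sum_lsum_le (xs ys : seq F) g : uniq (xs ++ ys) ->
  {in ys, forall y, lsum y g = q%:R *: g} -> \sum_l g l = 0 ->
  \sum_(x <- xs) ip g (lsum x g) <= q%:R * (d - size ys)%N%:R * ip g g.
Proof.
have q_neq0 : q%:R != 0 :> rat by rewrite pnatr_eq0 -lt0n; apply/card_gt0P; exists 0.
elim: xs ys g => [|x xs IH] ys g U Hys g0.
  by rewrite big_nil !mulr_ge0 ?ler0n ?ip_ge0.
have Uys : uniq ys by move: U; rewrite cat_uniq => /and3P[].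
have [ys_d|ys_d] := ltnP d (size ys).
  rewrite (lsum_eigen_const Uys ys_d Hys g0) /ip !big1 ?mulr0 //= => [l _|y _].
    by rewrite ffunE mul0r.
  by apply: big1 => l _; rewrite ffunE mul0r.
pose p := q%:R^-1 *: lsum x g; pose h := g - p.
have Ux : uniq (xs ++ x :: ys).
  by rewrite -cat1s uniq_catCA.
have lp : lsum x p = q%:R *: p by rewrite lsumZ lsumK !scalerA mulrC.
have lh : lsum x h = 0 by rewrite lsumB lp /p scalerA divff // scale1r subrr.
have lyp y : lsum y g = q%:R *: g -> lsum y p = q%:R *: p.
  by move=> Hy; rewrite lsumZ lsumC Hy lsumZ !scalerA mulrC.
have p_sum : \sum_l p l = 0.
  under eq_bigr => l _ do rewrite !ffunE.
  rewrite -mulr_sumr exchange_big big1 ?mulr0 // => t _.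
  by rewrite -[RHS]g0 [RHS](reindex _ (onW_bij _ (shift_bij x t))).
have Hp : {in x :: ys, forall y, lsum y p = q%:R *: p}.
  by move=> y; rewrite inE => /orP[/eqP-> //|/Hys/lyp].
have Hh : {in ys, forall y, lsum y h = q%:R *: h}.
  by move=> y yys; rewrite lsumB Hys // lyp ?Hys // -scalerBr.
have h0 : \sum_l h l = 0.
  have -> : \sum_l h l = \sum_l g l - \sum_l p l.
    by rewrite -sumrB; apply: eq_bigr => l _; rewrite !ffunE.
  by rewrite g0 p_sum subrr.
have orth f : lsum x f = 0 -> ip p f = 0.
  by move=> Ef; rewrite ipZl ip_lsum Ef ip0r mulr0.
have gE : g = p + h by rewrite addrC subrK.
have split y : ip g (lsum y g) = ip p (lsum y p) + ip h (lsum y h).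
  have -> : lsum y g = lsum y p + lsum y h by rewrite /h lsumB addrC subrK.
  rewrite gE ipDl !ipDr.
  have -> : ip p (lsum y h) = 0 by apply: orth; rewrite lsumC lh lsum0.
  have -> : ip h (lsum y p) = 0 by rewrite -ip_lsum ipC orth // lsumC lh lsum0.
  by rewrite addr0 add0r.
have ipg : ip g g = ip p p + ip h h.
  by rewrite gE ipDl (ipDr p p h) (ipDr h p h) (ipC h p) (orth h lh) addr0 add0r.
have := IH ys h _ Hh h0; have := IH (x :: ys) p Ux Hp p_sum.
rewrite big_cons (eq_bigr _ (fun y _ => split y)) big_split /= split lp lh ipg ip0r.
rewrite (ipC p (q%:R *: p)) (ipZl q%:R p p).
have /= /andP[_ Uxs] := U; move=> Ip /(_ Uxs) Ih.
(* Below d, the part [p] gets q from the direction x and q (d - size ys - 1) by induction. At d the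
   truncated subtraction would lose this unit, but then [p] is constant in d + 1 directions and
   vanishes. *)
have [ys_d'|ys_d'] := ltnP (size ys) d.
  rewrite -(subnSK ys_d') -natr1 in Ih *; rewrite [size _]/= in Ip.
  rewrite addr0 addrA; apply: le_trans (lerD (lerD (lexx _) Ip) Ih) _.
  by rewrite le_eqVlt; apply/orP; left; apply/eqP; ring.
have p0 : p = 0 by apply: (lsum_eigen_const (ys := x :: ys)); rewrite //=; move: U => /=;
  rewrite mem_cat cat_uniq negb_or => /andP[/andP[_ ->]].
suff pp : ip p p = 0.
  have E : \sum_(j <- xs) ip p (lsum j p) = 0.
    by apply: big1 => j _; rewrite p0 /ip; apply: big1 => l _; rewrite ffunE mul0r.
  by rewrite pp E mulr0 !add0r.
by rewrite p0 ip0r.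
Qed.

Lemma wenger_sum g x v : \sum_(l | wenger l (x, v)) g l = lsum x g (0, - v).
Proof.
rewrite lift_sum_left ffunE; apply: eq_bigr => t _; congr (g (_, _)).
  by rewrite add0r.
by rewrite addrC.
Qed.

(** The squared sums over all lines of direction x add up to (g, lsum x g), so [sum_lsum_le] is
    applied to all of F with no invariant direction given. *)
Lemma wenger_mixing : mixing wenger (q * d)%:R.
Proof.
move=> g0 sum0; pose g : {ffun E -> rat^o} := [ffun l => g0 l].
have gE (P : pred E) : \sum_(l | P l) g0 l = \sum_(l | P l) g l.
  by apply: eq_bigr => l _; rewrite ffunE.
have -> : \sum_l g0 l ^+ 2 = ip g g by apply: eq_bigr => l _; rewrite ffunE expr2.
have -> : \sum_r (\sum_(l | wenger l r) g0 l) ^+ 2 = \sum_(x <- enum F) ip g (lsum x g).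
  rewrite big_enum /=.
  rewrite (eq_bigr (fun r => lsum r.1 g (0, - r.2) ^+ 2)) => [|[x v] _]; last first.
    by rewrite gE wenger_sum.
  rewrite -(pair_bigA _ (fun x v => lsum x g (0, - v) ^+ 2)) /=.
  apply: eq_bigr => x _; rewrite /ip.
  rewrite [RHS](eq_bigr (fun l => g (l.1, l.2) * lsum x g (l.1, l.2))) => [|[]//].
  rewrite -(pair_bigA _ (fun p u => g (p, u) * lsum x g (p, u))) /=.
  under [RHS]eq_bigr => p _.
    rewrite (reindex_inj (h := fun v => p *: moment x - v)) /=; last first.
      by move=> v w /addrI /oppr_inj.
    under eq_bigr => v _.
      have -> : lsum x g (p, p *: moment x - v) = lsum x g (0, - v).
        rewrite -(lsum_shift x p g (0, - v)); congr (lsum x g (_, _)).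
          by rewrite add0r.
        by rewrite addrC.
      over.
    over.
  rewrite exchange_big; apply: eq_bigr => v _.
  rewrite -mulr_suml expr2; congr (_ * _); rewrite ffunE; apply: eq_bigr => t _.
  by congr (g (_, _)); rewrite ?add0r //= addrC.
have U : uniq (enum F ++ [::]) by rewrite cats0 enum_uniq.
have := sum_lsum_le U (g := g); rewrite subn0 -natrM; apply=> //.
by rewrite -gE.
Qed.

End Wenger.

Lemma sqr_sum_le (I : finType) (g : I -> rat) :
  (\sum_i g i) ^+ 2 <= #|I|%:R * \sum_i g i ^+ 2.
Proof.
have := cauchy_schwarz predT g (fun=> 1); rewrite expr1n sumr_const mulrC.
by under eq_bigr => i _ do rewrite mulr1.
Qed.

(** * Spectral bound for the twisted Wenger graphs *)

Section TwistedWenger.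
Variables (F : finFieldType) (d : nat).
Hypothesis two_neq0 : 2 != 0 :> F.
Local Notation V := ('rV[F]_d * F)%type.
Local Notation E := (F * V)%type.
Local Notation q := #|F|.

Definition twist (p x : F) : V := (p *: moment d x, p ^+ 2 * x).

Definition twisted_wenger : rel E := ab_lift twist.

Section ZeroFiberSums.
Variable h : E -> rat.
Hypothesis h0 : forall x (v : 'rV[F]_d), \sum_w h (x, (v, w)) = 0.

Let H x := \sum_v h (x, v) ^+ 2.
Let diff (x x' p : F) : V := twist p x' - twist p x.
(** This sums h over the ends with first coordinate x' of the walks of length two from the right
    vertex (x, v), the middle vertex having first coordinate p. *)
Let M x x' (v : V) := \sum_p h (x', v + diff x x' p).

(* As [p] varies, the last coordinate of the shift is affine with slope
   2 s (x' - x), so it runs over a whole fiber. *)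
Lemma sum_shift_diff x x' s v : x != x' -> s != 0 ->
  \sum_p h (x', v + (diff x x' (p + s) - diff x x' p)) = 0.
Proof.
move=> xx' s0; set b := x' - x.
have b0 : b != 0 by rewrite subr_eq0 eq_sym.
rewrite -[RHS](h0 x' (v.1 + s *: (moment d x' - moment d x))).
have k0 : 2 * s * b != 0 by rewrite !mulf_neq0.
rewrite [RHS](reindex_inj (h := fun p => v.2 + (s ^+ 2 * b) + 2 * s * b * p)); last first.
  by move=> p p' /addrI/(mulfI k0).
apply: eq_bigr => p _; congr (h (_, _)); case: v => v1 v2.
rewrite /diff /twist /=; congr pair => /=; last by rewrite /b; ring.
congr (v1 + _); rewrite !scalerDl scalerBr.
by rewrite !opprD !opprK; apply/rowP => j; rewrite !mxE; ring.
Qed.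

(** The square is expanded over pairs (p, p + s). The terms with s nonzero cancel by
    [sum_shift_diff], and s = 0 contributes q times the norm. *)
Lemma sum_sqr_M x x' : x != x' -> \sum_v M x x' v ^+ 2 = q%:R * H x'.
Proof.
move=> xx'.
under eq_bigr => v _ do rewrite expr2 big_distrlr /=.
rewrite exchange_big /=; under eq_bigr => p _ do rewrite exchange_big /=.
pose G s v := h (x', v) * \sum_p h (x', v + (diff x x' (p + s) - diff x x' p)).
have -> : \sum_p \sum_p' \sum_v h (x', v + diff x x' p) * h (x', v + diff x x' p') =
          \sum_s \sum_v G s v.
  transitivity (\sum_p \sum_s \sum_v
      h (x', v) * h (x', v + (diff x x' (p + s) - diff x x' p))).
    apply: eq_bigr => p _; rewrite (reindex_inj (addrI p)) /=; apply: eq_bigr => s _.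
    rewrite [RHS](reindex_inj (addIr (diff x x' p))) /=; apply: eq_bigr => v _.
    by rewrite -addrA [diff x x' p + _]addrC subrK.
  rewrite exchange_big /=; apply: eq_bigr => s _; rewrite exchange_big /=.
  by apply: eq_bigr => v _; rewrite -mulr_sumr.
rewrite (bigD1 0) //= [X in _ + X]big1 ?addr0 => [|s s0]; last first.
  by apply: big1 => v _; rewrite /G sum_shift_diff // mulr0.
rewrite /H mulr_sumr; apply: eq_bigr => v _; rewrite /G.
under eq_bigr => p _ do rewrite addr0 subrr addr0.
by rewrite sumr_const expr2 mulr_natl mulrnAr.
Qed.

(** Walks of length two that return to the same x contribute q. For x and x' distinct, [sum_sqr_M]
    and Cauchy-Schwarz bound the square of the contribution by q H(x) H(x'); summed over all pairs
    this costs q^(3/2), and [rho] stands for the square root of q. *)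
Lemma zero_fiber_bound (rho : nat) : (q <= rho ^ 2)%N ->
  \sum_l (\sum_(r | twisted_wenger l r) h r) ^+ 2 <=
  (q + q * rho)%:R * \sum_r h r ^+ 2.
Proof.
move=> q_rho; set Y := \sum_l _.
have -> : \sum_r h r ^+ 2 = \sum_x H x.
  rewrite (eq_bigr (fun r => h (r.1, r.2) ^+ 2)) => [|[]//].
  by rewrite -(pair_bigA _ (fun x v => h (x, v) ^+ 2)).
set Ht := \sum_x H x.
pose C x x' := \sum_v h (x, v) * M x x' v.
have YE : Y = \sum_x \sum_x' C x x'.
  rewrite /Y (eq_bigr (fun l => (\sum_x h (x, twist l.1 x - l.2)) ^+ 2)) => [|[p u] _]; last first.
    by rewrite lift_sum_right.
  rewrite -(pair_bigA _ (fun p u => (\sum_x h (x, twist p x - u)) ^+ 2)) /=.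
  under eq_bigr => p _ do under eq_bigr => u _ do rewrite expr2 big_distrlr /=.
  under eq_bigr => p _ do rewrite exchange_big /=.
  rewrite exchange_big; apply: eq_bigr => x _ /=.
  under eq_bigr => p _ do rewrite exchange_big /=.
  rewrite exchange_big; apply: eq_bigr => x' _ /=.
  rewrite /C /M; under [RHS]eq_bigr => v _ do rewrite mulr_sumr.
  rewrite [RHS]exchange_big; apply: eq_bigr => p _ /=.
  rewrite [RHS](reindex_inj (h := fun u => twist p x - u)); last first.
    by move=> u w /addrI /oppr_inj.
  apply: eq_bigr => u _; congr (_ * h (_, _)).
  by rewrite [RHS]addrAC [twist p x + _]addrC subrK.
have Hge0 x : 0 <= H x by apply: sumr_ge0 => v _; apply: sqr_ge0.
have Ht_ge0 : 0 <= Ht by apply: sumr_ge0.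
have Cxx x : C x x = q%:R * H x.
  rewrite /H mulr_sumr; apply: eq_bigr => v _; rewrite /M.
  under eq_bigr => p _ do rewrite /diff subrr addr0.
  by rewrite sumr_const expr2 mulr_natl mulrnAr.
pose C' x x' := if x == x' then 0 else C x x'.
have YE' : Y - q%:R * Ht = \sum_x \sum_x' C' x x'.
  rewrite YE mulr_sumr -sumrB; apply: eq_bigr => x _.
  rewrite (bigD1 x) //= [RHS](bigD1 x) //= /C' eqxx add0r Cxx addrAC subrr add0r.
  by apply: eq_bigr => x' xx'; rewrite eq_sym (negbTE xx').
have C2 x x' : C' x x' ^+ 2 <= q%:R * (H x * H x').
  rewrite /C'; case: eqP => [_|/eqP xx'].
    by rewrite expr0n /= !mulr_ge0 ?ler0n.
  apply: le_trans (cauchy_schwarz _ _ _) _; rewrite sum_sqr_M //.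
  by rewrite -/(H x) mulrCA.
have sq : (Y - q%:R * Ht) ^+ 2 <= (q%:R * rho%:R * Ht) ^+ 2.
  rewrite YE'; apply: le_trans (sqr_sum_le _) _.
  apply: le_trans (_ : q%:R * \sum_x q%:R * \sum_x' C' x x' ^+ 2 <= _).
    by rewrite ler_wpM2l ?ler0n // ler_sum // => x _; apply: sqr_sum_le.
  apply: le_trans (_ : q%:R * \sum_x q%:R * \sum_x' q%:R * (H x * H x') <= _).
    rewrite ler_wpM2l ?ler0n // ler_sum // => x _; rewrite ler_wpM2l ?ler0n //.
    by rewrite ler_sum.
  have -> : q%:R * \sum_x q%:R * \sum_x' q%:R * (H x * H x') =
            q%:R ^+ 2 * q%:R * Ht ^+ 2.
    under eq_bigr => x _ do rewrite -mulr_sumr -mulr_sumr -/Ht.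
    by rewrite -!mulr_sumr -mulr_suml -/Ht; ring.
  rewrite !exprMn ler_wpM2r ?sqr_ge0 // ler_wpM2l ?sqr_ge0 //.
  by rewrite -natrX ler_nat.
have : Y - q%:R * Ht <= q%:R * rho%:R * Ht.
  have [Yneg|Ypos] := ltP (Y - q%:R * Ht) 0.
    by apply: le_trans (ltW Yneg) _; rewrite !mulr_ge0 ?ler0n.
  by rewrite -(ler_pXn2r (n := 2)) // nnegrE !mulr_ge0 ?ler0n.
by rewrite natrD natrM mulrDl lerBlDl.
Qed.

End ZeroFiberSums.

(** The average [g1] over the last coordinate sees only the Wenger graph, and the remainder [g2] has
    zero fiber sums. The constants come from (A + B)^2 <= 2 A^2 + 2 B^2 and |g2|^2 <= 4 |g|^2. *)
Lemma twisted_wenger_mixing (rho : nat) : (q <= rho ^ 2)%N ->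
  mixing twisted_wenger (2 * (q * d) + 8 * (q + q * rho))%:R.
Proof.
move=> q_rho g g0.
have q_gt0 : 0 < q%:R :> rat by rewrite ltr0n; apply/card_gt0P; exists 0.
have q_neq0 := lt0r_neq0 q_gt0.
pose gb (l : F * 'rV[F]_d) : rat := q%:R^-1 * \sum_w g (l.1, (l.2, w)).
pose g1 (l : E) := gb (l.1, l.2.1); pose g2 l := g l - g1 l.
have sumE (G : E -> rat) : \sum_l G l = \sum_p \sum_u \sum_w G (p, (u, w)).
  rewrite (eq_bigr (fun l => G (l.1, (l.2.1, l.2.2)))) => [|[? []]//].
  rewrite -(pair_bigA _ (fun p (v : V) => G (p, (v.1, v.2)))) /=.
  by apply: eq_bigr => p _; rewrite -(pair_bigA _ (fun u w => G (p, (u, w)))).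
have sumE2 (G : F * 'rV[F]_d -> rat) : \sum_l G l = \sum_p \sum_u G (p, u).
  rewrite (eq_bigr (fun l => G (l.1, l.2))) => [|[]//].
  by rewrite -(pair_bigA _ (fun p u => G (p, u))).
set S := \sum_l g l ^+ 2.
have S_ge0 : 0 <= S by apply: sumr_ge0 => l _; apply: sqr_ge0.
have gb2 : q%:R * \sum_l gb l ^+ 2 <= S.
  rewrite sumE2 /S sumE mulr_sumr ler_sum // => p _; rewrite mulr_sumr ler_sum // => u _.
  rewrite /gb /=; set s := \sum_w g _.
  have -> : q%:R * (q%:R^-1 * s) ^+ 2 = s ^+ 2 / q%:R by field.
  by rewrite ler_pdivrMr // mulrC; apply: sqr_sum_le.
have g1_2 : \sum_l g1 l ^+ 2 = q%:R * \sum_l gb l ^+ 2.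
  rewrite sumE sumE2 mulr_sumr; apply: eq_bigr => p _; rewrite mulr_sumr.
  by apply: eq_bigr => u _; rewrite /g1 /= sumr_const mulr_natl.
have gb0 : \sum_l gb l = 0.
  rewrite sumE2; under eq_bigr => p _ do rewrite -mulr_sumr.
  by rewrite -mulr_sumr -[X in _ * X]sumE g0 mulr0.
have part1 : \sum_r (\sum_(l | twisted_wenger l r) g1 l) ^+ 2 <= (q * d)%:R * S.
  have -> : \sum_r (\sum_(l | twisted_wenger l r) g1 l) ^+ 2 =
     q%:R * \sum_r (\sum_(l | wenger l r) gb l) ^+ 2.
    rewrite sumE sumE2 mulr_sumr; apply: eq_bigr => x _.
    rewrite mulr_sumr; apply: eq_bigr => v _.
    rewrite mulr_natl -sumr_const; apply: eq_bigr => w _.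
    by rewrite !lift_sum_left.
  apply: le_trans (_ : q%:R * ((q * d)%:R * \sum_l gb l ^+ 2) <= _).
    by rewrite ler_wpM2l ?ler0n //; apply: wenger_mixing.
  by rewrite mulrCA ler_wpM2l ?ler0n.
have g2_2 : \sum_l g2 l ^+ 2 <= 4 * S.
  apply: le_trans (_ : \sum_l (2 * g l ^+ 2 + 2 * g1 l ^+ 2) <= _).
    apply: ler_sum => l _; rewrite /g2 -subr_ge0.
    by rewrite (_ : _ - _ = (g l + g1 l) ^+ 2) ?sqr_ge0 //; ring.
  rewrite big_split /= -!mulr_sumr g1_2 -/S; lra.
have part2 : \sum_r (\sum_(l | twisted_wenger l r) g2 l) ^+ 2 <= (q + q * rho)%:R * (4 * S).
  apply: le_trans (_ : (q + q * rho)%:R * \sum_l g2 l ^+ 2 <= _); last first.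
    by rewrite ler_wpM2l ?ler0n.
  (* The image of [g2] also has zero fiber sums: for fixed p, varying the last coordinate of the
     right vertex runs over a whole fiber on the left. *)
  apply: adjoint_bound; rewrite ?ler0n //; apply: zero_fiber_bound => // x v.
  under eq_bigr => w _ do rewrite lift_sum_left.
  rewrite exchange_big big1 // => p _ /=.
  have := erefl (\sum_w g2 (p, (p *: moment d x - v, w))).
  rewrite {2}(reindex_inj (h := fun w => p ^+ 2 * x - w)) /=; last first.
    by move=> w w' /addrI/oppr_inj.
  move=> <-; rewrite /g2 sumrB /g1 /= sumr_const -mulr_natl /gb /=.
  by rewrite mulrA divff // mul1r subrr.
have : \sum_r (\sum_(l | twisted_wenger l r) g l) ^+ 2 <=
  2 * \sum_r (\sum_(l | twisted_wenger l r) g1 l) ^+ 2 +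
  2 * \sum_r (\sum_(l | twisted_wenger l r) g2 l) ^+ 2.
  rewrite !mulr_sumr -big_split ler_sum // => r _ /=.
  have -> : \sum_(l | twisted_wenger l r) g l =
    \sum_(l | twisted_wenger l r) g1 l + \sum_(l | twisted_wenger l r) g2 l.
    by rewrite -big_split; apply: eq_bigr => l _; rewrite /= /g2 [RHS]addrC subrK.
  set A := \sum_(l | _) g1 l; set B := \sum_(l | _) g2 l.
  by rewrite -subr_ge0 (_ : _ - _ = (A - B) ^+ 2) ?sqr_ge0 //; ring.
move=> H; apply: le_trans H _; rewrite natrD [(2 * _)%:R]natrM [(8 * _)%:R]natrM; lra.
Qed.

End TwistedWenger.

(** * Absence of short cycles *)

Lemma bip_cycle_free (W : finType) (a : rel W) m :
  (forall x z, ~~ x.1 -> uniq (x :: z) -> size (x :: z) = m -> ~~ cycle (bip a) (x :: z)) ->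
  (0 < m)%N -> forall z, uniq z -> size z = m -> ~~ cycle (bip a) z.
Proof.
move=> H m_gt0 [|x [|y z]] Uz zm; first by rewrite -zm in m_gt0.
  by rewrite /= andbT /bip; case: x.1.
have [x1|/H ->//] := boolP x.1.
apply/negP => Cz; have y1 : ~~ y.1.
  by have /= /andP[/bip_side -> _] := Cz; rewrite x1.
have Uy : uniq (y :: rcons z x) by rewrite -(rot_uniq 1) rot1_cons rcons_cons in Uz.
have /= := H y (rcons z x) y1 Uy; rewrite size_rcons => /(_ zm)/negP; apply.
by rewrite -(rot_cycle 1) rot1_cons rcons_cons in Cz.
Qed.

Section LiftCycles.
Variables (F : finFieldType) (V : finZmodType) (f : F -> F -> V).
Local Notation B := (bip (ab_lift f)).

(** Subtracting the equations of the two edges at y eliminates the second coordinate of y. *)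
Lemma bip_turn x y w : B x y -> B y w -> x != w ->
  [/\ x.2.1 != w.2.1, w.1 = x.1 &
      ~~ x.1 -> x.2.2 - w.2.2 = f x.2.1 y.2.1 - f w.2.1 y.2.1].
Proof.
move=> xy yw xw; have wx : w.1 = x.1 by rewrite (bip_side yw) (bip_side xy) negbK.
have yx := bip_side xy; move: xy yw xw wx; rewrite /bip yx.
case: x y w {yx} => [[] [p u]] [b' [t v]] [b [p' u']] /=; rewrite /ab_lift /=.
  move=> /eqP e1 /andP[_ /eqP e2] xw bE; split=> //; apply: contraNneq xw => pp'.
  by move: e2; rewrite bE -pp' -e1 => /addrI ->.
move=> /eqP e1 /andP[_ /eqP e2] xw bE; split=> //.
  by apply: contraNneq xw => pp'; move: e2; rewrite bE -pp' -e1 => /addIr ->.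
by move=> _; rewrite -e1 -e2 opprD addrACA subrr addr0.
Qed.

Lemma nth_uniq_neq (T : eqType) (x : T) (z : seq T) i j :
  uniq z -> (i < size z)%N -> (j < size z)%N -> i != j -> nth x z i != nth x z j.
Proof. by move=> Uz iz jz; rewrite nth_uniq. Qed.

(** The equations of [bip_turn] at the right vertices telescope around the cycle; the turns on both
    sides show that cyclically neighbouring p's, and x's, differ. Lengths 8 and 10 are alike. *)
Lemma lift_cycle6 x z : ~~ x.1 -> uniq (x :: z) -> size (x :: z) = 6%N ->
  cycle B (x :: z) -> exists p1 p2 p3 x1 x2 x3,
  [/\ [/\ p1 != p2, p2 != p3 & p3 != p1], [/\ x1 != x2, x2 != x3 & x3 != x1] &
    f p1 x1 - f p2 x1 + (f p2 x2 - f p3 x2) + (f p3 x3 - f p1 x3) = 0].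
Proof.
set s := x :: z => side_x Us size_s.
have D i j : (i < 6)%N -> (j < 6)%N -> i != j -> nth x s i != nth x s j.
  by rewrite -size_s; apply: nth_uniq_neq.
move: D Us size_s; rewrite {}/s.
case: z => [|z2 [|z3 [|z4 [|z5 [|z6 [|? ?]]]]]] // D _ _.
rewrite /= andbT => /and5P[b1 b2 b3 b4 /andP[b5 b6]].
have [P1 s3 E1] := bip_turn b1 b2 (D 0 2 isT isT isT).
have [P2 s5 E2] := bip_turn b3 b4 (D 2 4 isT isT isT).
have [P3 _ E3] := bip_turn b5 b6 (D 4 0 isT isT isT).
have [X1 _ _] := bip_turn b2 b3 (D 1 3 isT isT isT).
have [X2 _ _] := bip_turn b4 b5 (D 3 5 isT isT isT).
have [X3 _ _] := bip_turn b6 b1 (D 5 1 isT isT isT).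
exists x.2.1, z3.2.1, z5.2.1, z2.2.1, z4.2.1, z6.2.1; split; first by split.
  by split.
rewrite -E1 // -E2 -?E3 ?s5 ?s3 //.
by rewrite !addrA !subrK subrr.
Qed.

Lemma lift_cycle8 x z : ~~ x.1 -> uniq (x :: z) -> size (x :: z) = 8%N ->
  cycle B (x :: z) -> exists p1 p2 p3 p4 x1 x2 x3 x4,
  [/\ [/\ p1 != p2, p2 != p3, p3 != p4 & p4 != p1],
    [/\ x1 != x2, x2 != x3, x3 != x4 & x4 != x1] &
    f p1 x1 - f p2 x1 + (f p2 x2 - f p3 x2) + (f p3 x3 - f p4 x3) + (f p4 x4 - f p1 x4) = 0].
Proof.
set s := x :: z => side_x Us size_s.
have D i j : (i < 8)%N -> (j < 8)%N -> i != j -> nth x s i != nth x s j.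
  by rewrite -size_s; apply: nth_uniq_neq.
move: D Us size_s; rewrite {}/s.
case: z => [|z2 [|z3 [|z4 [|z5 [|z6 [|z7 [|z8 [|? ?]]]]]]]] // D _ _.
rewrite /= andbT => /and5P[b1 b2 b3 b4 /and4P[b5 b6 b7 b8]].
have [P1 s3 E1] := bip_turn b1 b2 (D 0 2 isT isT isT).
have [P2 s5 E2] := bip_turn b3 b4 (D 2 4 isT isT isT).
have [P3 s7 E3] := bip_turn b5 b6 (D 4 6 isT isT isT).
have [P4 _ E4] := bip_turn b7 b8 (D 6 0 isT isT isT).
have [X1 _ _] := bip_turn b2 b3 (D 1 3 isT isT isT).
have [X2 _ _] := bip_turn b4 b5 (D 3 5 isT isT isT).
have [X3 _ _] := bip_turn b6 b7 (D 5 7 isT isT isT).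
have [X4 _ _] := bip_turn b8 b1 (D 7 1 isT isT isT).
exists x.2.1, z3.2.1, z5.2.1, z7.2.1, z2.2.1, z4.2.1, z6.2.1, z8.2.1.
split; [by split | by split |].
rewrite -E1 // -E2 -?E3 -?E4 ?s7 ?s5 ?s3 //.
by rewrite !addrA !subrK subrr.
Qed.

Lemma lift_cycle10 x z : ~~ x.1 -> uniq (x :: z) -> size (x :: z) = 10%N ->
  cycle B (x :: z) -> exists p1 p2 p3 p4 p5 x1 x2 x3 x4 x5,
  [/\ [/\ p1 != p2, p2 != p3, p3 != p4, p4 != p5 & p5 != p1],
    [/\ x1 != x2, x2 != x3, x3 != x4, x4 != x5 & x5 != x1] &
    f p1 x1 - f p2 x1 + (f p2 x2 - f p3 x2) + (f p3 x3 - f p4 x3) +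
    (f p4 x4 - f p5 x4) + (f p5 x5 - f p1 x5) = 0].
Proof.
set s := x :: z => side_x Us size_s.
have D i j : (i < 10)%N -> (j < 10)%N -> i != j -> nth x s i != nth x s j.
  by rewrite -size_s; apply: nth_uniq_neq.
move: D Us size_s; rewrite {}/s.
case: z => [|z2 [|z3 [|z4 [|z5 [|z6 [|z7 [|z8 [|z9 [|z0 [|? ?]]]]]]]]]] // D _ _.
rewrite /= andbT => /and5P[b1 b2 b3 b4 /and5P[b5 b6 b7 b8 /andP[b9 b0]]].
have [P1 s3 E1] := bip_turn b1 b2 (D 0 2 isT isT isT).
have [P2 s5 E2] := bip_turn b3 b4 (D 2 4 isT isT isT).
have [P3 s7 E3] := bip_turn b5 b6 (D 4 6 isT isT isT).
have [P4 s9 E4] := bip_turn b7 b8 (D 6 8 isT isT isT).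
have [P5 _ E5] := bip_turn b9 b0 (D 8 0 isT isT isT).
have [X1 _ _] := bip_turn b2 b3 (D 1 3 isT isT isT).
have [X2 _ _] := bip_turn b4 b5 (D 3 5 isT isT isT).
have [X3 _ _] := bip_turn b6 b7 (D 5 7 isT isT isT).
have [X4 _ _] := bip_turn b8 b9 (D 7 9 isT isT isT).
have [X5 _ _] := bip_turn b0 b1 (D 9 1 isT isT isT).
exists x.2.1, z3.2.1, z5.2.1, z7.2.1, z9.2.1, z2.2.1, z4.2.1, z6.2.1, z8.2.1, z0.2.1.
split; [by split | by split |].
rewrite -E1 // -E2 -?E3 -?E4 -?E5 ?s9 ?s7 ?s5 ?s3 //.
by rewrite !addrA !subrK subrr.
Qed.

End LiftCycles.

(** The moments are combined with the coefficients of the polynomial (X - x2)(X - x3), which kills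
    the other nodes. The versions with more nodes do the same. *)
Lemma vandermonde3 (F : fieldType) (a1 a2 a3 x1 x2 x3 : F) :
  a1 + a2 + a3 = 0 -> a1 * x1 + a2 * x2 + a3 * x3 = 0 ->
  a1 * x1 ^+ 2 + a2 * x2 ^+ 2 + a3 * x3 ^+ 2 = 0 ->
  a1 * (x1 - x2) * (x1 - x3) = 0.
Proof.
move=> S0 S1 S2.
transitivity ((a1 * x1 ^+ 2 + a2 * x2 ^+ 2 + a3 * x3 ^+ 2) -
  (x2 + x3) * (a1 * x1 + a2 * x2 + a3 * x3) + x2 * x3 * (a1 + a2 + a3)); first ring.
by rewrite S0 S1 S2; ring.
Qed.

Lemma vandermonde4 (F : fieldType) (a1 a2 a3 a4 x1 x2 x3 x4 : F) :
  a1 + a2 + a3 + a4 = 0 -> a1 * x1 + a2 * x2 + a3 * x3 + a4 * x4 = 0 ->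
  a1 * x1 ^+ 2 + a2 * x2 ^+ 2 + a3 * x3 ^+ 2 + a4 * x4 ^+ 2 = 0 ->
  a1 * x1 ^+ 3 + a2 * x2 ^+ 3 + a3 * x3 ^+ 3 + a4 * x4 ^+ 3 = 0 ->
  a1 * (x1 - x2) * (x1 - x3) * (x1 - x4) = 0.
Proof.
move=> S0 S1 S2 S3.
transitivity ((a1 * x1 ^+ 3 + a2 * x2 ^+ 3 + a3 * x3 ^+ 3 + a4 * x4 ^+ 3) -
  (x2 + x3 + x4) * (a1 * x1 ^+ 2 + a2 * x2 ^+ 2 + a3 * x3 ^+ 2 + a4 * x4 ^+ 2) +
  (x2 * x3 + x2 * x4 + x3 * x4) * (a1 * x1 + a2 * x2 + a3 * x3 + a4 * x4) -
  x2 * x3 * x4 * (a1 + a2 + a3 + a4)); first ring.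
by rewrite S0 S1 S2 S3; ring.
Qed.

Lemma vandermonde5 (F : fieldType) (a1 a2 a3 a4 a5 x1 x2 x3 x4 x5 : F) :
  a1 + a2 + a3 + a4 + a5 = 0 -> a1 * x1 + a2 * x2 + a3 * x3 + a4 * x4 + a5 * x5 = 0 ->
  a1 * x1 ^+ 2 + a2 * x2 ^+ 2 + a3 * x3 ^+ 2 + a4 * x4 ^+ 2 + a5 * x5 ^+ 2 = 0 ->
  a1 * x1 ^+ 3 + a2 * x2 ^+ 3 + a3 * x3 ^+ 3 + a4 * x4 ^+ 3 + a5 * x5 ^+ 3 = 0 ->
  a1 * x1 ^+ 4 + a2 * x2 ^+ 4 + a3 * x3 ^+ 4 + a4 * x4 ^+ 4 + a5 * x5 ^+ 4 = 0 ->
  a1 * (x1 - x2) * (x1 - x3) * (x1 - x4) * (x1 - x5) = 0.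
Proof.
move=> S0 S1 S2 S3 S4.
transitivity (
  (a1 * x1 ^+ 4 + a2 * x2 ^+ 4 + a3 * x3 ^+ 4 + a4 * x4 ^+ 4 + a5 * x5 ^+ 4) -
  (x2 + x3 + x4 + x5) *
    (a1 * x1 ^+ 3 + a2 * x2 ^+ 3 + a3 * x3 ^+ 3 + a4 * x4 ^+ 3 + a5 * x5 ^+ 3) +
  (x2 * x3 + x2 * x4 + x2 * x5 + x3 * x4 + x3 * x5 + x4 * x5) *
    (a1 * x1 ^+ 2 + a2 * x2 ^+ 2 + a3 * x3 ^+ 2 + a4 * x4 ^+ 2 + a5 * x5 ^+ 2) -
  (x2 * x3 * x4 + x2 * x3 * x5 + x2 * x4 * x5 + x3 * x4 * x5) *
    (a1 * x1 + a2 * x2 + a3 * x3 + a4 * x4 + a5 * x5) +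
  x2 * x3 * x4 * x5 * (a1 + a2 + a3 + a4 + a5)); first ring.
by rewrite S0 S1 S2 S3 S4; ring.
Qed.

Lemma wenger6_free (F : finFieldType) z :
  uniq z -> size z = 6%N -> ~~ cycle (bip (@wenger F 2)) z.
Proof.
move: z; apply: bip_cycle_free => // y z y1 Uz zm; apply/negP => Cz.
have [p1 [p2 [p3 [x1 [x2 [x3 [[p12 p23 p31] [x12 x23 x31]]]]]]]] := lift_cycle6 y1 Uz zm Cz.
move=> /rowP E; have := E (@Ordinal 2 0 isT); have := E (@Ordinal 2 1 isT).
rewrite !mxE /= => S2 S1.
have T0 : p1 - p2 + (p2 - p3) + (p3 - p1) = 0 by ring.
have T1 : (p1 - p2) * x1 + (p2 - p3) * x2 + (p3 - p1) * x3 = 0.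
  by rewrite -[RHS]S1; ring.
have T2 : (p1 - p2) * x1 ^+ 2 + (p2 - p3) * x2 ^+ 2 + (p3 - p1) * x3 ^+ 2 = 0.
  by rewrite -[RHS]S2; ring.
have /eqP := vandermonde3 T0 T1 T2.
by rewrite !mulf_eq0 !subr_eq0 (negbTE p12) (negbTE x12) eq_sym (negbTE x31).
Qed.

Lemma repeated_node5 (F : fieldType) (a1 a2 a3 a4 a5 x1 x2 x3 x4 x5 : F) :
  a1 + a2 + a3 + a4 + a5 = 0 -> a1 * x1 + a2 * x2 + a3 * x3 + a4 * x4 + a5 * x5 = 0 ->
  a1 * x1 ^+ 2 + a2 * x2 ^+ 2 + a3 * x3 ^+ 2 + a4 * x4 ^+ 2 + a5 * x5 ^+ 2 = 0 ->
  a1 * x1 ^+ 3 + a2 * x2 ^+ 3 + a3 * x3 ^+ 3 + a4 * x4 ^+ 3 + a5 * x5 ^+ 3 = 0 ->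
  a1 * x1 ^+ 4 + a2 * x2 ^+ 4 + a3 * x3 ^+ 4 + a4 * x4 ^+ 4 + a5 * x5 ^+ 4 = 0 ->
  a1 != 0 -> x1 != x2 -> x5 != x1 -> (x1 == x3) || (x1 == x4).
Proof.
move=> S0 S1 S2 S3 S4 a0 x12 x51; have /eqP := vandermonde5 S0 S1 S2 S3 S4.
by rewrite !mulf_eq0 !subr_eq0 (negbTE a0) (negbTE x12) [x1 == x5]eq_sym (negbTE x51) orbF.
Qed.

(** Each of five cyclically arranged nodes must equal another one, never an adjacent one. Classes of
    equal nodes would then all have exactly two elements, but five is odd. *)
Lemma wenger10_free (F : finFieldType) z :
  uniq z -> size z = 10%N -> ~~ cycle (bip (@wenger F 4)) z.
Proof.
move: z; apply: bip_cycle_free => // y z y1 Uz zm; apply/negP => Cz.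
have [p1 [p2 [p3 [p4 [p5 [x1 [x2 [x3 [x4 [x5 [[p12 p23 p34 p45 p51]]]]]]]]]]]] :=
  lift_cycle10 y1 Uz zm Cz.
move=> [x12 x23 x34 x45 x51] /rowP E; have := E (@Ordinal 4 0 isT).
have := E (@Ordinal 4 1 isT); have := E (@Ordinal 4 2 isT); have := E (@Ordinal 4 3 isT).
rewrite !mxE /= => S4 S3 S2 S1 {E}.
move: p12 p23 p34 p45 p51; rewrite -!(subr_eq0 p1) -!(subr_eq0 p2) -!(subr_eq0 p3)
  -!(subr_eq0 p4) -!(subr_eq0 p5).
have : p1 - p2 + (p2 - p3) + (p3 - p4) + (p4 - p5) + (p5 - p1) = 0 by ring.
have {S1} : (p1 - p2) * x1 + (p2 - p3) * x2 + (p3 - p4) * x3 + (p4 - p5) * x4 +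
  (p5 - p1) * x5 = 0 by rewrite -[RHS]S1; ring.
have {S2} : (p1 - p2) * x1 ^+ 2 + (p2 - p3) * x2 ^+ 2 + (p3 - p4) * x3 ^+ 2 +
  (p4 - p5) * x4 ^+ 2 + (p5 - p1) * x5 ^+ 2 = 0 by rewrite -[RHS]S2; ring.
have {S3} : (p1 - p2) * x1 ^+ 3 + (p2 - p3) * x2 ^+ 3 + (p3 - p4) * x3 ^+ 3 +
  (p4 - p5) * x4 ^+ 3 + (p5 - p1) * x5 ^+ 3 = 0 by rewrite -[RHS]S3; ring.
have {S4} : (p1 - p2) * x1 ^+ 4 + (p2 - p3) * x2 ^+ 4 + (p3 - p4) * x3 ^+ 4 +
  (p4 - p5) * x4 ^+ 4 + (p5 - p1) * x5 ^+ 4 = 0 by rewrite -[RHS]S4; ring.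
move: (p1 - p2) (p2 - p3) (p3 - p4) (p4 - p5) (p5 - p1) => a1 a2 a3 a4 a5.
move=> T4 T3 T2 T1 T0 n1 n2 n3 n4 n5.
have /orP E1 : (x1 == x3) || (x1 == x4) by apply: repeated_node5 T0 T1 T2 T3 T4 _ _ _.
have rot5 (b1 b2 b3 b4 b5 : F) : b1 + b2 + b3 + b4 + b5 = 0 -> b2 + b3 + b4 + b5 + b1 = 0.
  by move=> <-; ring.
have /rot5 U0 := T0; have /rot5 U1 := T1; have /rot5 U2 := T2.
have /rot5 U3 := T3; have /rot5 U4 := T4.
have /orP E2 := repeated_node5 U0 U1 U2 U3 U4 n2 x23 x12.
move: (U0) (U1) (U2) (U3) (U4) => /rot5 V0 /rot5 V1 /rot5 V2 /rot5 V3 /rot5 V4.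
have /orP E3 := repeated_node5 V0 V1 V2 V3 V4 n3 x34 x23.
move: (V0) (V1) (V2) (V3) (V4) => /rot5 W0 /rot5 W1 /rot5 W2 /rot5 W3 /rot5 W4.
have /orP E4 := repeated_node5 W0 W1 W2 W3 W4 n4 x45 x34.
move: (W0) (W1) (W2) (W3) (W4) => /rot5 Z0 /rot5 Z1 /rot5 Z2 /rot5 Z3 /rot5 Z4.
have /orP E5 := repeated_node5 Z0 Z1 Z2 Z3 Z4 n5 x51 x45.
move: x12 x23 x34 x45 x51.
by case: E1 => /eqP E1; case: E2 => /eqP E2; case: E3 => /eqP E3; case: E4 => /eqP E4;
  case: E5 => /eqP E5; subst; rewrite ?eqxx.
Qed.

(** The moments force x3 = x1 and x4 = x2. Then p1 - p2 + p3 - p4 = 0, the twist coordinate gives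
    the same relation for squares, and together they yield 2 (p1 - p4)(p1 - p2) = 0. *)
Lemma twisted_wenger8_free (F : finFieldType) z : 2 != 0 :> F ->
  uniq z -> size z = 8%N -> ~~ cycle (bip (@twisted_wenger F 3)) z.
Proof.
move=> two_neq0; move: z; apply: bip_cycle_free => // y z y1 Uz zm; apply/negP => Cz.
have [p1 [p2 [p3 [p4 [x1 [x2 [x3 [x4 [[p12 p23 p34 p41]]]]]]]]]] := lift_cycle8 y1 Uz zm Cz.
move=> [x12 x23 x34 x41] [/rowP E]; have := E (@Ordinal 3 0 isT).
have := E (@Ordinal 3 1 isT); have := E (@Ordinal 3 2 isT).
rewrite !mxE /= => S3 S2 S1 {E} Q.
have T0 : p1 - p2 + (p2 - p3) + (p3 - p4) + (p4 - p1) = 0 by ring.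
have T1 : (p1 - p2) * x1 + (p2 - p3) * x2 + (p3 - p4) * x3 + (p4 - p1) * x4 = 0.
  by rewrite -[RHS]S1; ring.
have T2 : (p1 - p2) * x1 ^+ 2 + (p2 - p3) * x2 ^+ 2 + (p3 - p4) * x3 ^+ 2 +
  (p4 - p1) * x4 ^+ 2 = 0 by rewrite -[RHS]S2; ring.
have T3 : (p1 - p2) * x1 ^+ 3 + (p2 - p3) * x2 ^+ 3 + (p3 - p4) * x3 ^+ 3 +
  (p4 - p1) * x4 ^+ 3 = 0 by rewrite -[RHS]S3; ring.
have x13 : x3 = x1.
  have /eqP := vandermonde4 T0 T1 T2 T3.
  rewrite !mulf_eq0 !subr_eq0 (negbTE p12) (negbTE x12) [x1 == x4]eq_sym (negbTE x41) orbF.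
  by move=> /eqP.
have x24 : x4 = x2.
  have rot4 (b1 b2 b3 b4 : F) : b1 + b2 + b3 + b4 = 0 -> b2 + b3 + b4 + b1 = 0.
    by move=> <-; ring.
  have /eqP := vandermonde4 (rot4 _ _ _ _ T0) (rot4 _ _ _ _ T1) (rot4 _ _ _ _ T2)
    (rot4 _ _ _ _ T3).
  rewrite !mulf_eq0 !subr_eq0 (negbTE p23) (negbTE x23) [x2 == x1]eq_sym (negbTE x12) orbF.
  by move=> /eqP.
have xn0 : x1 - x2 != 0 by rewrite subr_eq0.
have L : p1 - p2 + (p3 - p4) = 0.
  by apply: (mulIf xn0); rewrite mul0r -[RHS]T1 x13 x24; ring.
have L2 : (p1 ^+ 2 - p2 ^+ 2) + (p3 ^+ 2 - p4 ^+ 2) = 0.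
  by apply: (mulIf xn0); rewrite mul0r -[RHS]Q x13 x24; ring.
have p3E : p3 = p2 + p4 - p1.
  by rewrite -[LHS]subr0 -L; ring.
have : 2 * (p1 - p4) * (p1 - p2) == 0.
  by apply/eqP; rewrite -[RHS]L2 p3E; ring.
by rewrite !mulf_eq0 !subr_eq0 (negbTE two_neq0) [p1 == p4]eq_sym (negbTE p41) (negbTE p12).
Qed.

Local Close Scope ring_scope.

(** * Choice of the parameters *)

(** The inequality on c is the one of [few_bad] with 3 D d = q = 3^e; sets of proportion 1/D of a
    side are to be mixed. *)
Definition mixing_family (k m : nat) := forall D, 0 < D -> exists e0, forall e, e0 <= e ->
  exists (W : finType) (a : rel W) (c : nat),
  [/\ #|W| = (3 ^ e) ^ k, forall r, #|[set l | a l r]| = 3 ^ e,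
      forall l, #|[set r | a l r]| = 3 ^ e,
      mixing a c%:R%R /\ c * (9 * D ^ 3) <= 4 * (3 ^ e) ^ 2 &
      forall z, uniq z -> size z = m -> ~~ cycle (bip a) z].

Lemma leq_pexp e b : e <= b -> e <= 3 ^ b.
Proof. by move=> eb; apply: leq_trans eb (ltnW (ltn_expl _ _)). Qed.

Lemma wenger_family d m :
  (forall (F : finFieldType) z, uniq z -> size z = m -> ~~ cycle (bip (@wenger F d)) z) ->
  mixing_family d.+1 m.
Proof.
move=> free D D_gt0; exists (9 * d * D ^ 3).+1 => e e_ge.
have [F _ cardF] := pPrimePowerField (isT : prime 3) (leq_trans (ltn0Sn _) e_ge).
exists (F * 'rV[F]_d)%type, (@wenger F d), (3 ^ e * d); split.
- by rewrite card_prod card_mx cardF mul1n expnS.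
- by move=> r; rewrite card_lift_left.
- by move=> r; rewrite card_lift_right.
- split; first by rewrite -cardF; apply: wenger_mixing.
  have := leq_pexp (ltnW e_ge); nia.
- exact: free.
Qed.

Lemma twisted_family : mixing_family 5 8.
Proof.
(* The threshold makes 3^(e/2) at least 200 D^3, which suffices since 22 * 9 D^3 = 198 D^3 is needed
   to be at most 4 * 3^(e/2). *)
move=> D D_gt0; exists (400 * D ^ 3).+1 => e e_ge.
have [F p3 cardF] := pPrimePowerField (isT : prime 3) (leq_trans (ltn0Sn _) e_ge).
have two_neq0 : (2 != 0 :> F)%R.
  apply/eqP => two0; have := pcharf0 p3.
  by rewrite (_ : 3 = 2 + 1) // natrD two0 add0r => /eqP; rewrite oner_eq0.
exists (F * ('rV[F]_3 * F))%type, (@twisted_wenger F 3),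
  (2 * (3 ^ e * 3) + 8 * (3 ^ e + 3 ^ e * 3 ^ uphalf e)); split.
- by rewrite !card_prod card_mx cardF mul1n; ring.
- by move=> r; rewrite card_lift_left.
- by move=> r; rewrite card_lift_right.
- split.
    rewrite -cardF; apply: twisted_wenger_mixing => //.
    by rewrite cardF -expnM leq_exp2l // muln2; lia.
  have E : 3 ^ e = 3 ^ uphalf e * 3 ^ e./2 by rewrite -expnD; congr (3 ^ _); lia.
  have h1 : 200 * D ^ 3 <= 3 ^ e./2 by apply: leq_pexp; lia.
  have h2 : 0 < 3 ^ uphalf e by rewrite expn_gt0.
  have h3 : 2 * 3 + 8 * (1 + 3 ^ uphalf e) <= 22 * 3 ^ uphalf e by lia.
  have h4 : (2 * 3 + 8 * (1 + 3 ^ uphalf e)) * (9 * D ^ 3) <= 4 * 3 ^ e.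
    apply: leq_trans (leq_mul h3 (leqnn _)) _; rewrite E.
    rewrite [22 * _]mulnC -mulnA [4 * _]mulnCA leq_mul2l; apply/orP; right.
    by move: (D ^ 3) (3 ^ e./2) h1 => D3 y; lia.
  rewrite (_ : 2 * _ + _ = 3 ^ e * (2 * 3 + 8 * (1 + 3 ^ uphalf e))); last by ring.
  by rewrite -mulnA (_ : 4 * _ = 3 ^ e * (4 * 3 ^ e)) ?leq_mul2l ?h4 ?orbT //; ring.
- by move=> z; apply: twisted_wenger8_free.
Qed.

(** Here D = 3^s and d = 3^(e - s - 1); working with powers of 3 makes q = 3 D d and N = D N' exact.
    Bad left vertices are handled through the transposed graph. *)
Lemma H_cycle_family k m : mixing_family k m -> 2 < m -> 0 < k ->
  forall s, exists e0, forall e K x, e0 <= e -> 0 < K ->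
  let N := (3 ^ e) ^ k in let N' := 3 ^ (e * k - s) in let n := K * N.*2 + x in
  m * (K * (N' * 4).+1).+2 <= x ->
  H_cycle n m * (3 ^ (e - s.+1)) ^ (K * (N - N').*2) <= n ^ n * (n ^ 2) ^ x.
Proof.
move=> fam m_gt2 k_gt0 s; have D_gt0 : 0 < 3 ^ s by rewrite expn_gt0.
have [e1 H] := fam _ D_gt0; exists (maxn e1 s.+1) => e K x.
rewrite geq_max => /andP[e1_e s_e] K_gt0 N N' n x_ge.
have [W [a [c [cardW degL degR [mix c_le] free]]]] := H e e1_e.
have s_ek : s <= e * k by apply: leq_trans (ltnW s_e) (leq_pmulr _ _).
have q3 : 3 ^ e = 3 * 3 ^ s * 3 ^ (e - s.+1) by rewrite -expnS -expnD subnKC.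
have NE : N = 3 ^ s * N' by rewrite /N -expnM -expnD subnKC.
have d_gt0 : 0 < 3 ^ (e - s.+1) by rewrite expn_gt0.
have N'_gt0 : 0 < N' by rewrite expn_gt0.
move: NE x_ge; rewrite {}/n {}/N -cardW => NE x_ge.
apply: (H_cycle_greedy (a := a)) => //.
- by rewrite NE muln_gt0 D_gt0.
- by rewrite leq_exp2l // leq_sub // ?leq_pmulr.
- by rewrite NE leq_pmull.
- move=> U; apply: (few_bad (a := fun r l => a l r) (D := 3 ^ s) (c := c)) => //.
  + exact: mixing_transpose mix degL.
  + by move=> r; rewrite -q3 degR.
  + by rewrite -q3.
- move=> U; apply: (few_bad (a := a) (D := 3 ^ s) (c := c)) => //.
  + by move=> r; rewrite -q3 degL.
  + by rewrite -q3.
Qed.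

(** The exponent e is the largest with 2 D 3^(e k) <= n. About 3 m n / D vertices are set aside as
    extra ones, and as many copies as fit use up the others. *)
Lemma H_cycle_parameters k m : mixing_family k m -> 2 < m -> 0 < k ->
  forall s, (3 * m).+1 < 3 ^ s -> exists n0, forall n, n0 <= n -> exists e A x,
  [/\ s < e, n < 2 * 3 ^ s * 3 ^ (e.+1 * k), x <= n /\ x * 3 ^ s <= (3 * m).+1 * n,
      A * 3 ^ s = (n - x) * (3 ^ s - 1) &
      H_cycle n m * (3 ^ (e - s.+1)) ^ A <= n ^ n * (n ^ 2) ^ x].
Proof.
move=> fam m_gt2 k_gt0 s; have [e0 He0] := H_cycle_family fam m_gt2 k_gt0 s.
have [D DE] : {D | D = 3 ^ s} by exists (3 ^ s).
rewrite -DE => D_ge; have D_gt0 : 0 < D by rewrite DE expn_gt0.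
have D2_gt0 : 0 < 2 * D by rewrite muln_gt0.
exists (3 ^ (maxn e0 s.+1 * k) * (2 * D) + 4 * D) => n n_ge.
have [v vE] : {v | v = n %/ (2 * D)} by exists (n %/ (2 * D)).
have v_ge : 3 ^ (maxn e0 s.+1 * k) <= v.
  by rewrite vE leq_divRL //; apply: leq_trans n_ge; apply: leq_addr.
have v_gt0 : 0 < v by apply: leq_trans v_ge; rewrite expn_gt0.
have /andP[] := trunc_log_bounds (isT : 1 < 3) v_gt0; move: (trunc_log 3 v) => u u_le u_gt.
have [e eE] : {e | e = u %/ k} by exists (u %/ k).
have e_ge : maxn e0 s.+1 <= e.
  by rewrite eE leq_divRL // -ltnS -(ltn_exp2l (m := 3)) //; apply: leq_ltn_trans v_ge u_gt.
have /andP[e0_e s_e] : (e0 <= e) && (s < e) by rewrite -geq_max.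
have s_ek : s <= e * k by apply: leq_trans (ltnW s_e) (leq_pmulr _ _).
have [N N_def] : {N | N = 3 ^ (e * k)} by exists (3 ^ (e * k)).
have [N' N'_def] : {N' | N' = 3 ^ (e * k - s)} by exists (3 ^ (e * k - s)).
have NE : N = D * N' by rewrite N_def DE N'_def -expnD subnKC.
have N'_gt0 : 0 < N' by rewrite N'_def expn_gt0.
have N_gt0 : 0 < N by rewrite N_def expn_gt0.
have N_le : N * (2 * D) <= n.
  rewrite -leq_divRL // -vE; apply: leq_trans u_le; rewrite N_def leq_exp2l // eE.
  exact: leq_divM.
have n_lt : n < 2 * D * 3 ^ (e.+1 * k).
  rewrite mulnC -ltn_divLR // -vE; apply: leq_trans u_gt _.
  by rewrite leq_exp2l // eE ltn_ceil.
have [t tE] : {t | t = n %/ D} by exists (n %/ D).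
have tD : t * D <= n by rewrite tE leq_divM.
have t_ge4 : 4 <= t by rewrite tE leq_divRL //; apply: leq_trans n_ge; apply: leq_addl.
have N_t : 2 * N <= t by rewrite tE leq_divRL // (_ : 2 * N * D = N * (2 * D)) //; ring.
have mt_le : (3 * m).+1 * t <= n by apply: leq_trans tD; rewrite mulnC leq_mul2l ltnW ?orbT.
have mt_le' : 3 * m * t + t <= n by rewrite addnC -mulSn.
have [K KE] : {K | K = (n - 3 * m * t) %/ (2 * N)} by exists ((n - 3 * m * t) %/ (2 * N)).
have N2_gt0 : 0 < 2 * N by rewrite muln_gt0.
have K_le : K * (2 * N) <= n - 3 * m * t by rewrite KE leq_divM.
have K_gt : n - 3 * m * t < K.+1 * (2 * N) by rewrite KE ltn_ceil.
have K_gt0 : 0 < K.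
  by rewrite KE divn_gt0 //; move: mt_le' N_t; clear; move: (3 * m * t) => y; lia.
have [x xE] : {x | x = n - K * N.*2} by exists (n - K * N.*2).
rewrite -mul2n in xE.
have x_le : x <= (3 * m).+1 * t.
  by rewrite mulSn; move: xE K_le K_gt mt_le' N_t; rewrite (mulSn K);
     move: (3 * m * t) (K * (2 * N)) => y z; clear; lia.
have nE : n = K * N.*2 + x.
  by rewrite -mul2n; move: xE K_le mt_le'; clear;
     move: (3 * m * t) (K * (2 * N)) => y z; lia.
have KN' : 2 * (K * N') <= t.
  rewrite tE leq_divRL //; apply: leq_trans (leq_trans K_le (leq_subr _ _)).
  by rewrite NE (_ : 2 * _ * _ = K * (2 * (D * N'))) //; ring.
(* From 2 K N' <= t and K <= K N' one gets 4 K N' + K + 2 <= 2 t + t / 2 + 2 <= 3 t, as t >= 4. *)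
have x_ge : m * (K * (N' * 4).+1).+2 <= x.
  apply: (@leq_trans (m * (3 * t))); last first.
    rewrite mulnCA mulnA; move: xE K_le mt_le'; clear.
    by move: (3 * m * t) (K * (2 * N)) => y z; lia.
  rewrite leq_mul2l; apply/orP; right; rewrite mulnS.
  have : K <= K * N' by rewrite leq_pmulr.
  by rewrite mulnA; move: KN' t_ge4; clear; move: (K * N') => y; lia.
exists e, (K * (N - N').*2), x; split => //.
- split; first by rewrite xE leq_subr.
  by apply: leq_trans (leq_mul x_le (leqnn D)) _; rewrite -mulnA leq_mul2l tD orbT.
- rewrite {1}nE addnK NE -[D * N' - N']/(_ - _) -{2}[N']mul1n -mulnBl -!mul2n; ring.
- by have /= := He0 e K x e0_e K_gt0; rewrite -(expnM 3 e k) -N_def -N'_def -nE; apply.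
Qed.

End MixingGraphs.

From Stdlib Require Import Reals Lra.

(** * Passage to logarithms and asymptotics *)

Section RealEstimates.
Notation "m ^ n" := (expn m n) : nat_scope.

Lemma INR_leq a b : (a <= b)%N -> (INR a <= INR b)%R.
Proof. by move=> /ssrnat.leP; apply: le_INR. Qed.

Lemma INR_muln a b : INR (a * b) = (INR a * INR b)%R.
Proof. by rewrite -multE mult_INR. Qed.

Lemma INR_expn a b : INR (a ^ b) = (INR a ^ b)%R.
Proof. by elim: b => [//|b IH]; rewrite expnS INR_muln IH. Qed.

Lemma Rdiv_le a b c : (0 < b)%R -> (a <= c * b)%R -> (a / b <= c)%R.
Proof.
move=> b_gt0 ac; apply: (Rmult_le_reg_r b) => //.
by rewrite /Rdiv Rmult_assoc Rinv_l ?Rmult_1_r //; lra.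
Qed.

Lemma Rle_div a b c : (0 < b)%R -> (a * b <= c)%R -> (a <= c / b)%R.
Proof.
move=> b_gt0 ac; apply: (Rmult_le_reg_r b) => //.
by rewrite /Rdiv Rmult_assoc Rinv_l ?Rmult_1_r //; lra.
Qed.

Lemma INR_subn a b : (b <= a)%N -> INR (a - b) = (INR a - INR b)%R.
Proof. by move=> /ssrnat.leP; rewrite -minusE; apply: minus_INR. Qed.

Lemma ln_le a b : (0 < a)%R -> (a <= b)%R -> (ln a <= ln b)%R.
Proof. by move=> a_gt0 [/(ln_increasing _ _ a_gt0)|->]; lra. Qed.

Lemma ln_pow_INR a b : (0 < a)%R -> ln (a ^ b) = (INR b * ln a)%R.
Proof. by move=> a_gt0; rewrite ln_pow. Qed.

(* The hypotheses mean x = O(n / D), A = n - O(n / D) and that 3^e is of order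
   n^(1/k); [C] absorbs the constant factors. *)
Lemma ln_estimate (k m s e x A n H : nat) (D := (3 ^ s)%N) (C := (INR (2 * s + 3) * ln 3)%R) :
  (0 < k)%N -> (0 < n)%N -> (0 < H)%N -> (s < e)%N -> (n < 2 * D * 3 ^ (e.+1 * k))%N ->
  (x <= n)%N -> (x * D <= (3 * m).+1 * n)%N -> (A * D = (n - x) * (D - 1))%N ->
  (H * (3 ^ (e - s.+1)) ^ A <= n ^ n * (n ^ 2) ^ x)%N ->
  (ln (INR H) <= (1 - 1 / INR k + INR (9 * m + 4) / INR D) * (INR n * ln (INR n))
     + INR n * C)%R.
Proof.
move=> k_gt0 n_gt0 H_gt0 s_e n_lt x_n xD AD H_le.
have pos a : (0 < a)%N -> (0 < INR a)%R by move=> /ssrnat.ltP; apply: lt_0_INR.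
have D_gt0 : (0 < D)%N by rewrite expn_gt0.
have kR := pos _ k_gt0; have nR := pos _ n_gt0; have HR := pos _ H_gt0; have DR := pos _ D_gt0.
have xR := pos_INR x; have AR := pos_INR A; have sR := pos_INR s.
have l3 : (0 < ln 3)%R by rewrite -ln_1; apply: ln_increasing; lra.
have l23 : (ln 2 < ln 3)%R by apply: ln_increasing; lra.
have k1 : (1 <= INR k)%R by apply: (@INR_leq 1).
have INR3 : INR 3 = 3%R by rewrite /=; lra.
have INR2 : INR 2 = 2%R by rewrite /=; lra.
set L := ln (INR n).
have L_ge0 : (0 <= L)%R.
  have [n1|n1] : (1 = INR n \/ 1 < INR n)%R by have := INR_leq n_gt0; rewrite /=; lra.
    by rewrite /L -n1 ln_1; lra.
  by have := ln_increasing _ _ Rlt_0_1 n1; rewrite ln_1 -/L; lra.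
have L_le : (L <= ln 2 + INR s * ln 3 + INR k * ((INR e + 1) * ln 3))%R.
  have -> : (ln 2 + INR s * ln 3 + INR k * ((INR e + 1) * ln 3) =
             ln (INR (2 * D * 3 ^ (e.+1 * k))))%R.
    rewrite !INR_muln !INR_expn INR2 INR3 !ln_mult;
      try apply: Rmult_lt_0_compat; try apply: pow_lt; try lra.
    by rewrite !ln_pow_INR ?INR_muln ?S_INR; try lra.
  by apply/Rlt_le/ln_increasing => //; apply: lt_INR; apply/ssrnat.ltP.
have main : (ln (INR H) + INR A * (INR (e - s.+1) * ln 3) <= INR n * L + INR x * (2 * L))%R.
  have -> : (ln (INR H) + INR A * (INR (e - s.+1) * ln 3) =
             ln (INR (H * (3 ^ (e - s.+1)) ^ A)))%R.
    rewrite INR_muln !INR_expn INR3 ln_mult //; last by do 2!apply: pow_lt; lra.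
    by rewrite !ln_pow_INR //; try apply: pow_lt; lra.
  have -> : (INR n * L + INR x * (2 * L) = ln (INR (n ^ n * (n ^ 2) ^ x)))%R.
    rewrite INR_muln !INR_expn ln_mult; try by repeat apply: pow_lt.
    rewrite !ln_pow_INR //; try by apply: pow_lt.
  apply: ln_le; last by apply: INR_leq.
  by apply: pos; rewrite muln_gt0 H_gt0 !expn_gt0.
have AE : (INR A * INR D = (INR n - INR x) * (INR D - 1))%R.
  have := congr1 INR AD; rewrite !INR_muln INR_subn // INR_subn //.
have xDR : (INR x * INR D <= (3 * INR m + 1) * INR n)%R.
  have := INR_leq xD; rewrite !INR_muln S_INR INR_muln INR3; lra.
have esE : INR (e - s.+1) = (INR e - INR s - 1)%R by rewrite INR_subn // S_INR; lra.
have xnR := INR_leq x_n.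
set y := (INR (e - s.+1) * ln 3)%R in main.
have CE : C = ((2 * INR s + 3) * ln 3)%R.
  by rewrite /C -plusE plus_INR INR_muln INR2 INR3.
have C_ge0 : (0 <= C)%R by rewrite CE; nra.
(* The bound on n gives L / k <= ln 2 + (s + e + 1) ln 3, which exceeds y by ln 2 + (2 s + 2) ln 3 <
   C. *)
have y_ge : (L / INR k - C <= y)%R.
  have : (L / INR k <= (ln 2 + INR s * ln 3) + (INR e + 1) * ln 3)%R.
    apply: Rdiv_le => //.
    have : (0 <= (ln 2 + INR s * ln 3) * (INR k - 1))%R.
      apply: Rmult_le_pos; last lra.
      by have := ln_lt_2; have := Rmult_le_pos _ _ sR (Rlt_le _ _ l3); lra.
    lra.
  rewrite /y esE CE; nra.
set u := (L / INR k)%R in y_ge.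
have u_ge0 : (0 <= u)%R by apply: Rle_div; lra.
have u_L : (u <= L)%R by apply: Rdiv_le => //; nra.
have A_le : (INR A <= INR n)%R by nra.
have A_ge : (INR n - INR x - INR n / INR D <= INR A)%R.
  have -> : INR A = ((INR n - INR x) * (INR D - 1) / INR D)%R.
    by rewrite -AE; field; lra.
  apply: Rle_div => //; have : (INR n / INR D * INR D = INR n)%R by field; lra.
  nra.
have x_le : (INR x <= (3 * INR m + 1) * INR n / INR D)%R by apply: Rle_div.
set nD := (INR n / INR D)%R in A_ge *.
have xD' : (INR x <= (3 * INR m + 1) * nD)%R by rewrite /nD /Rdiv in x_le *; lra.
have nD_ge0 : (0 <= nD)%R by apply: Rle_div; lra.
(* The coefficient is 9 m + 4 = 3 (3 m + 1) + 1: x L occurs twice in [main] and once in the loss n -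
   A, which also contains n / D. *)
have -> : ((1 - 1 / INR k + INR (9 * m + 4) / INR D) * (INR n * L) + INR n * C =
  INR n * L - INR n * u + (9 * INR m + 4) * nD * L + INR n * C)%R.
  rewrite -plusE plus_INR INR_muln.
  have -> : INR 9 = 9%R by rewrite /=; lra.
  have -> : INR 4 = 4%R by rewrite /=; lra.
  by rewrite /u /nD; field; lra.
have h1 : (INR A * (u - C) <= INR A * y)%R by apply: Rmult_le_compat_l.
have h2 : (INR A * C <= INR n * C)%R by apply: Rmult_le_compat_r.
have h3 : ((INR n - INR x - nD) * u <= INR A * u)%R by apply: Rmult_le_compat_r.
have h4 : ((INR x + nD) * u <= (INR x + nD) * L)%R by apply: Rmult_le_compat_l; lra.
have h5 : (INR x * L <= (3 * INR m + 1) * nD * L)%R by apply: Rmult_le_compat_r.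
lra.
Qed.

(** Half of eps absorbs (9 m + 4) / D by the choice of s; with s fixed, the other half absorbs C /
    ln n for large n. *)
Lemma H_cycle_asymptotic k m : mixing_family k m -> (2 < m)%N -> (0 < k)%N ->
  forall eps : R, (0 < eps)%R -> exists N : nat, forall n : nat, (N <= n)%N ->
  (INR (H_cycle n m) <= Rpower (INR n) ((1 - 1 / INR k + eps) * INR n))%R.
Proof.
move=> fam m_gt2 k_gt0 eps eps_gt0.
have [s1 s1_gt] := INR_unbounded (2 * INR (9 * m + 4) / eps).
pose s := ((3 * m).+2 + s1)%N; pose C := (INR (2 * s + 3) * ln 3)%R.
have s_D : (s < 3 ^ s)%N by apply: ltn_expl.
have D_ge : ((3 * m).+1 < 3 ^ s)%N.
  by apply: leq_ltn_trans s_D; rewrite /s addSn ltnW // ltnS leq_addr.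
have [n0 Hn0] := H_cycle_parameters fam m_gt2 k_gt0 D_ge.
have [n1 n1_gt] := INR_unbounded (exp (2 * C / eps)).
exists (n0 + n1.+1)%N => n n_ge.
have n0_n : (n0 <= n)%N by apply: leq_trans n_ge; apply: leq_addr.
have n1_n : (n1 < n)%N by apply: leq_trans n_ge; apply: leq_addl.
have [e [A [x [s_e n_lt [x_n xD] AD H_le]]]] := Hn0 n n0_n.
have [->|H_gt0] := posnP (H_cycle n m); first by apply/Rlt_le/exp_pos.
have n_gt0 : (0 < n)%N by apply: leq_ltn_trans n1_n.
have nR : (0 < INR n)%R by apply: lt_0_INR; apply/ssrnat.ltP.
have := ln_estimate k_gt0 n_gt0 H_gt0 s_e n_lt x_n xD AD H_le.
rewrite -/C; set L := ln (INR n) => est.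
have L_ge : (2 * C / eps <= L)%R.
  rewrite -(ln_exp (2 * C / eps)); apply: ln_le; first exact: exp_pos.
  by have := INR_leq (ltnW n1_n); lra.
have D_gt : (2 * INR (9 * m + 4) / eps <= INR (3 ^ s))%R.
  have := INR_leq (ltnW (leq_ltn_trans (leq_addl _ _ : s1 <= s)%N s_D)); lra.
have DR : (0 < INR (3 ^ s))%R by apply: lt_0_INR; apply/ssrnat.ltP; rewrite expn_gt0.
have c1 : (INR (9 * m + 4) / INR (3 ^ s) <= eps / 2)%R.
  apply: Rdiv_le => //.
  have := Rmult_le_compat_l _ _ _ (Rlt_le _ _ eps_gt0) D_gt.
  have -> : (eps * (2 * INR (9 * m + 4) / eps) = 2 * INR (9 * m + 4))%R by field; lra.
  lra.
have c2 : (C <= eps / 2 * L)%R.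
  have := Rmult_le_compat_l _ _ _ (Rlt_le _ _ eps_gt0) L_ge.
  have -> : (eps * (2 * C / eps) = 2 * C)%R by field; lra.
  lra.
have C_ge0 : (0 <= C)%R.
  apply: Rmult_le_pos; first exact: pos_INR.
  by rewrite -ln_1; apply: ln_le; lra.
have L_ge0 : (0 <= L)%R by apply: Rle_trans L_ge; apply: Rle_div; lra.
have nL_ge0 : (0 <= INR n * L)%R by apply: Rmult_le_pos; lra.
rewrite /Rpower -/L -(exp_ln (INR (H_cycle n m))); last by apply: lt_0_INR; apply/ssrnat.ltP.
have [] : (ln (INR (H_cycle n m)) <= (1 - 1 / INR k + eps) * INR n * L)%R; last first.
- by move=> ->; apply: Rle_refl.
- by move=> /exp_increasing/Rlt_le.
apply: Rle_trans est _.
have := Rmult_le_compat_r _ _ _ nL_ge0 c1.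
have := Rmult_le_compat_l _ _ _ (Rlt_le _ _ nR) c2.
lra.
Qed.

End RealEstimates.

(* H_n(C_m) <= n^{c n + o(n)}  is stated as: for every eps > 0, for all
   sufficiently large n, H_n(C_m) <= n^{(c + eps) n}. *)
Theorem theorem2 :
  (forall eps : R, (0 < eps)%R -> exists N : nat, forall n : nat, (N <= n)%N ->
     (INR (H_cycle n 6) <= Rpower (INR n) ((2/3 + eps) * INR n))%R) /\
  (forall eps : R, (0 < eps)%R -> exists N : nat, forall n : nat, (N <= n)%N ->
     (INR (H_cycle n 8) <= Rpower (INR n) ((4/5 + eps) * INR n))%R) /\
  (forall eps : R, (0 < eps)%R -> exists N : nat, forall n : nat, (N <= n)%N ->
     (INR (H_cycle n 10) <= Rpower (INR n) ((4/5 + eps) * INR n))%R).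
Proof.
have E3 : (2 / 3 = 1 - 1 / INR 3)%R by rewrite /=; field.
have E5 : (4 / 5 = 1 - 1 / INR 5)%R by rewrite /=; field.
rewrite E3 E5; split; last split.
- exact: H_cycle_asymptotic (wenger_family wenger6_free) isT isT.
- exact: H_cycle_asymptotic twisted_family isT isT.
- exact: H_cycle_asymptotic (wenger_family wenger10_free) isT isT.
Qed.
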